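(* Let $P$ be a hull configuration of $n$ points. Then $\textsc{NC}(P)$ is a union of maximal Boolean subposets; that is, every $\pi\in\textsc{NC}(P)$ lies in some subset of $\textsc{NC}(P)$ which, with the induced order, is isomorphic to the Boolean lattice $\textsc{Bool}(n-1)$ of all subsets of an $(n-1)$-element set.
   Context: A configuration is a finite set $P$ of $n$ distinct points in the plane. $P$ is a hull configuration if either its convex hull $\textsc{Conv}(P)$ is one-dimensional or no point of $P$ lies in the interior of $\textsc{Conv}(P)$. A set partition of $P$ is noncrossing if the convex hulls of its blocks are pairwise disjoint; $\textsc{NC}(P)$ is the poset of noncrossing partitions of $P$ ordered by refinement. *)

(* Defs.v *)
From HB Require Import structures.
From mathcomp Require Import all_boot all_order all_algebra finmap.
From mathcomp Require Import all_classical all_reals topology normedtype convex.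
Set Implicit Arguments.
Unset Strict Implicit.
Unset Printing Implicit Defensive.
Import Order.TTheory GRing.Theory Num.Theory.
Import numFieldNormedType.Exports.
Local Open Scope classical_set_scope.
Local Open Scope ring_scope.

Notation plane R := 'rV[R]_2.

Definition convex_hull (R : realType) (E : lmodType R) (X : set E) : set E :=
  smallest (@convex_set R E) X.

(* [V] is the direction of the affine hull of [X], i.e., the least subspace
   containing all differences of elements of [X]. *)
Definition is_direction (R : realType) (E : vectType R) (X : set E)
    (V : {vspace E}) : Prop :=
  (forall x y, X x -> X y -> x - y \in V) /\
  (forall W : {vspace E},
     (forall x y, X x -> X y -> x - y \in W) -> (V <= W)%VS).

Definition has_affine_dim (R : realType) (E : vectType R) (X : set E)
    (k : nat) : Prop :=
  X !=set0 /\ exists2 V : {vspace E}, is_direction X V & \dim V = k.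

(* The interior is taken in the topology of the plane, so it is empty when the
   hull has dimension less than 2. *)
Definition hull_configuration (R : realType) (P : {fset plane R}) : Prop :=
  has_affine_dim (convex_hull [set` P]) 1 \/
  forall p, p \in P -> ~ interior (convex_hull [set` P]) p.

Section NoncrossingPartitions.
Context {R : realType}.
Implicit Type P : {fset plane R}.

(* Subsets of a configuration [P] have type [{set fset_sub_type P}], where
   [fset_sub_type P] is the finite type of the elements of [P]. *)
Definition block_points P (B : {set fset_sub_type P}) : set (plane R) :=
  [set val x | x in [set` B]].

Definition noncrossing P (pi : {set {set fset_sub_type P}}) : Prop :=
  forall B C, B \in pi -> C \in pi -> B != C ->
    convex_hull (block_points B) `&` convex_hull (block_points C) = set0.

Definition NC P :=
  { pi : {set {set fset_sub_type P}} |
    finset.partition pi [set: fset_sub_type P]%SET && `[< noncrossing pi >]}.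

HB.instance Definition _ P := Finite.on (NC P).

Definition refines P (pi rho : NC P) : bool :=
  [forall B in val pi, exists C in val rho, B \subset C].

Lemma refinesP P (pi rho : NC P) :
  reflect (forall B, B \in val pi -> exists2 C, C \in val rho & B \subset C)
          (refines pi rho).
Proof. exact: 'forall_in_'exists_in_idP. Qed.

Fact refines_refl P : reflexive (@refines P).
Proof. by move=> pi; apply/refinesP => B piB; exists B. Qed.

Fact refines_trans P : transitive (@refines P).
Proof.
move=> rho pi sigma /refinesP pr /refinesP rs; apply/refinesP => B /pr[C].
by move=> /rs[D sD sCD] sBC; exists D => //; apply: fintype.subset_trans sCD.
Qed.

Fact refines_anti P : antisymmetric (@refines P).
Proof.
have sub (pi rho : NC P) : refines pi rho -> refines rho pi ->
    {subset val pi <= val rho}.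
  move=> /refinesP pr /refinesP rp B piB.
  have [C rC sBC] := pr _ piB; have [D piD sCD] := rp _ rC.
  have /andP[/and3P[_ /finset.trivIsetP tI nz] _] := valP pi.
  have BD : B = D.
    apply/eqP/contraT => /(tI _ _ piB piD) /disjoint_setI0 BD0.
    have B0 : B = finset.set0.
      by rewrite -BD0; apply/esym/finset.setIidPl/(fintype.subset_trans sBC).
    by rewrite B0 (negPf nz) in piB.
  suff -> : B = C by [].
  by apply/eqP; rewrite finset.eqEsubset sBC BD.
move=> pi rho /andP[pr rp]; apply/val_inj/finset.setP => B.
by apply/idP/idP; apply: sub.
Qed.

Fact refinement_display : Order.disp_t. Proof. exact: Order.Disp tt tt. Qed.

HB.instance Definition _ P :=
  Order.Le_isPOrder.Build refinement_display (NC P)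
    (@refines_refl P) (@refines_anti P) (@refines_trans P).

End NoncrossingPartitions.

Arguments NC {R} P.

Definition boolean_subposet (d : Order.disp_t) (T : finPOrderType d)
    (S : {set T}) (k : nat) : Prop :=
  exists f : {set 'I_k} -> {x : T | x \in S},
    bijective f /\
    forall A B : {set 'I_k}, (val (f A) <= val (f B))%O = (A \subset B).

(* Main.v *)
Require Import Defs.
From HB Require Import structures.
From mathcomp Require Import all_boot all_order all_algebra finmap.
From mathcomp Require Import zify ring lra.
Set Implicit Arguments.
Unset Strict Implicit.
Unset Printing Implicit Defensive.

(* The points of a hull configuration are cyclically ordered along the boundary
   of the hull. A partition is noncrossing iff no two blocks interlace in this
   order and no block skips a point lying on a segment between two of its
   points; points of the latter kind are the nonextreme ones.

   A Boolean subposet through [pi] comes from a spanning tree [t] of the points: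
   a set [A] of edges is sent to the partition into connected components of
   [(P, A)], and [pi] is one of these partitions. All of them are noncrossing
   iff [t] is noncrossing and all its leaves are extreme points. Such a tree is
   built by induction on the number of points. A noncrossing partition has two
   neighbours in one block or a singleton block; this provides a point [i] to be
   removed. If [i] is nonextreme, it is put back by subdividing an edge on the
   tree path between its two neighbours. If [i] is extreme, it is put back as a
   leaf at a neighbour, which is declared extreme beforehand.

   A tree is represented by the bipartitions that its edges induce: two points
   are connected by the edges in [A] iff no edge outside [A] separates them. So
   neither paths nor connectivity have to be considered. *)

(** * Cyclic orders and trees of cuts *)

(** Geometry serves only to translate between convex hulls and the conditions [noncross] and [flat];
    the induction runs on a finite cyclic order with an arbitrary set [V] of points called extreme.
    This freedom is needed: deleting a vertex of the hull changes which points are extreme, and the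
    set wanted afterwards need not be that of the smaller configuration. Making one neighbour of the
    deleted point extreme leaves only chords ending at that neighbour to be checked. It also allows
    the neighbour to be a leaf of the smaller tree, which it ceases to be when the point is attached
    to it. The invariant that [V] has at least two elements guarantees that the long arc between a
    new point and its neighbour, if it contains further points, contains an extreme one, so that
    [flat] demands nothing there. The induction hypothesis speaks of all edge sets, not only of the
    one that gives [pi]. Besides being the goal, this is indispensable for subdivision: a claim
    about one edge set is proved by passing to a larger one in which an old point can replace the
    new point. *)

Definition cyc_order {T : Type} (pos : T -> nat) (x y z : T) : bool :=
  [|| (pos x < pos y) && (pos y < pos z), (pos y < pos z) && (pos z < pos x)
    | (pos z < pos x) && (pos x < pos y)].

Local Ltac cyc_lia := rewrite /cyc_order; clear; lia.

Section CyclicOrder.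
Context {T : finType} (pos : T -> nat).
Implicit Types (x y z w i j : T) (S V : {set T}) (R : T -> T -> Prop).

Local Notation cyc := (cyc_order pos).

(** The chords [a c] and [b d] interlace. Concluding [R a b] forces all four points into one class,
    so blocks need not be mentioned. *)
Definition noncross S R : Prop :=
  forall a b c d, a \in S -> b \in S -> c \in S -> d \in S ->
    cyc a b c -> cyc c d a -> R a c -> R b d -> R a b.

(** In a hull configuration, an arc from [u] to [v] without extreme points lies on the segment
    [u v], so a block containing both ends must contain the arc. *)
Definition flat S V R : Prop :=
  forall u v, u \in S -> v \in S -> R u v ->
    (forall w, w \in S -> cyc u w v -> w \notin V) ->
    forall w, w \in S -> cyc u w v -> R u w.

Definition equiv R : Prop :=
  [/\ forall x, R x x, forall x y, R x y -> R y x
    & forall x y z, R x y -> R y z -> R x z].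

(* Adjacency of [i] and [j] in the cyclic order of [S], in either direction:
   no two further points of [S] separate them. *)
Definition adjacent S i j : Prop :=
  forall x y, x \in S -> y \in S -> x != i -> y != i -> x != j -> y != j ->
    cyc i x y = cyc j x y.

Hypothesis pos_inj : injective pos.

Lemma pos_neq x y : x != y -> pos x <> pos y.
Proof. by move=> /eqP nxy /pos_inj. Qed.

Lemma cyc_neq x y z : cyc x y z -> [/\ x != y, y != z & z != x].
Proof.
by rewrite /cyc_order => h; split; apply/negP => /eqP eq; move: h; rewrite eq; lia.
Qed.

(** The successor is the candidate with the fewest points on the arc from [i]; a point on that arc
    would be a better candidate. *)
Lemma exists_succ S i : i \in S -> 1 < #|S| ->
  exists j, [/\ j \in S, j != i & forall w, w \in S -> ~~ cyc i w j].
Proof.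
move=> iS S1; have /card_gt0P[j0 j0S] : 0 < #|S :\ i|.
  by move: S1; rewrite (cardsD1 i) iS.
case: (arg_minnP (fun j => #|[set w in S | cyc i w j]|) j0S) => j /setD1P[ji jS] jmin.
exists j; split=> // w wS; apply/negP => cw.
have [iw _ _] := cyc_neq cw.
have /jmin : w \in S :\ i by rewrite !inE eq_sym iw.
rewrite leqNgt => /negP; apply; apply: proper_card; apply/properP; split.
  apply/subsetP => x; rewrite !inE => /andP[-> /= cx].
  by move: cw cx; cyc_lia.
exists w; rewrite !inE wS //=; by cyc_lia.
Qed.

Lemma exists_pred S i : i \in S -> 1 < #|S| ->
  exists h, [/\ h \in S, h != i & forall w, w \in S -> ~~ cyc h w i].
Proof.
move=> iS S1; have /card_gt0P[j0 j0S] : 0 < #|S :\ i|.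
  by move: S1; rewrite (cardsD1 i) iS.
case: (arg_minnP (fun j => #|[set w in S | cyc j w i]|) j0S) => j /setD1P[ji jS] jmin.
exists j; split=> // w wS; apply/negP => cw.
have [_ wi _] := cyc_neq cw.
have /jmin : w \in S :\ i by rewrite !inE wi.
rewrite leqNgt => /negP; apply; apply: proper_card; apply/properP; split.
  apply/subsetP => x; rewrite !inE => /andP[-> /= cx].
  by move: cw cx; cyc_lia.
exists w; rewrite !inE wS //=; by cyc_lia.
Qed.

Lemma succ_adjacent S i j : i \in S -> j \in S -> j != i ->
  (forall w, w \in S -> ~~ cyc i w j) -> adjacent S i j.
Proof.
move=> iS jS ji h x y xS yS xi yi xj yj.
move: (h x xS) (h y yS).
move/pos_neq: xi; move/pos_neq: yi; move/pos_neq: xj; move/pos_neq: yj.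
move/pos_neq: ji; cyc_lia.
Qed.

Lemma adjacent_sym S i j : adjacent S i j -> adjacent S j i.
Proof. by move=> h x y xS yS xi yi xj yj; rewrite h. Qed.

(** A crossing that involves [i] in another position is rotated until [i] comes first; transitivity
    of [R] carries the conclusion back. *)
Lemma noncross_rec S R i : equiv R -> i \in S ->
  noncross (S :\ i) R ->
  (forall b c d, b \in S :\ i -> c \in S :\ i -> d \in S :\ i ->
     cyc i b c -> cyc c d i -> R i c -> R b d -> R i b) ->
  noncross S R.
Proof.
move=> [rR sR tR] iS nc nci a b c d aS bS cS dS h1 h2 ac bd.
have [ab bc ca] := cyc_neq h1; have [cd da _] := cyc_neq h2.
have mem x : x \in S -> x != i -> x \in S :\ i by move=> ? ?; rewrite !inE; apply/andP.
have [ai|ai] := eqVneq a i; first subst a.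
  by apply: (nci b c d) => //; apply: mem; rewrite // eq_sym.
have aS' := mem a aS ai.
have [bi|bi] := eqVneq b i; first subst b.
  have : R i c; last by move=> /sR ci; exact: (tR _ _ _ ac ci).
  have cS' : c \in S :\ i by apply: mem; rewrite // eq_sym.
  have [di|di] := eqVneq d i; first by move: h1 h2; rewrite di; cyc_lia.
  apply: (nci c d a cS' (mem d dS di) aS') => //; last exact: sR.
  - by move: h1 h2; cyc_lia.
  - by move: h1 h2; cyc_lia.
have bS' := mem b bS bi.
have [ci|ci] := eqVneq c i; first subst c.
  have : R i d; last by move=> id; exact: (tR _ _ _ ac (tR _ _ _ id (sR _ _ bd))).
  have dS' : d \in S :\ i by apply: mem; rewrite // eq_sym.
  by apply: (nci d a b dS' aS' bS') => //; exact: sR.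
have cS' := mem c cS ci.
have [di|di] := eqVneq d i; first subst d.
  have : R i a; last by move=> ia; exact: (sR _ _ (tR _ _ _ bd ia)).
  apply: (nci a b c aS' bS' cS') => //; last exact: sR.
  - by move: h1 h2; cyc_lia.
  - by move: h1 h2; cyc_lia.
exact: (nc a b c d aS' bS' cS' (mem d dS di)).
Qed.

End CyclicOrder.

(** * Trees encoded by the cuts of their edges *)

Section Cuts.
Context {T : finType}.
Implicit Types (x y i c : T) (S : {set T}) (chi : nat -> T -> bool) (a b : nat -> T).

(* A tree on the vertex set [S] with edges [(a e, b e)] for [e < n], recorded
   by the bipartitions [chi e] that deleting one edge induces on [S]. *)
Record cut_tree S n chi a b : Prop := CutTree {
  ct_memL : forall e, e < n -> a e \in S;
  ct_memR : forall e, e < n -> b e \in S;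
  ct_cut : forall e, e < n -> chi e (a e) != chi e (b e);
  ct_other : forall e f, e < n -> f < n -> f != e -> chi f (a e) = chi f (b e);
  ct_laminar : forall e f, e < n -> f < n -> e != f -> forall x, x \in S ->
    chi e x = chi e (a f) \/ chi f x = chi f (a e);
  ct_points : forall x y, x \in S -> y \in S ->
    (forall e, e < n -> chi e x = chi e y) -> x = y
}.

(* Two vertices are connected by the edges in [A] iff no edge outside [A]
   separates them. *)
Definition joined n chi (A : pred nat) x y : Prop :=
  forall e, e < n -> ~~ A e -> chi e x = chi e y.

Lemma joined_equiv n chi (A : pred nat) : equiv (joined n chi A).
Proof.
split=> [x e _ _ //|x y h e en Ae|x y z h1 h2 e en Ae]; first by rewrite h.
by rewrite h1 // h2.
Qed.

Lemma joined_sub n chi (A B : pred nat) x y :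
  (forall e, A e -> B e) -> joined n chi A x y -> joined n chi B x y.
Proof. by move=> AB h e en Be; apply: h => //; apply: contra Be; exact: AB. Qed.

Lemma bool_neqP (p q r : bool) : p != q -> r != q -> p = r.
Proof. by case: p q r => [] [] []. Qed.

Section Fixed.
Context {S : {set T}} {n : nat} {chi : nat -> T -> bool} {a b : nat -> T}.
Hypothesis tree : cut_tree S n chi a b.

(** The path from [x] to [y] runs through [e0], hence visits [a e0]. In terms of cuts: if an edge
    outside [A] separated [a e0] from [x], and so from [y], laminarity would put [x] and [y] on the
    same side of [e0]. *)
Lemma joined_end e0 (A : pred nat) x y : e0 < n -> x \in S -> y \in S ->
  joined n chi A x y -> chi e0 x != chi e0 y -> joined n chi A (a e0) x.
Proof.
move=> e0n xS yS xy sep e en Ae.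
have [ee|ee0] := eqVneq e e0; first by move: sep; rewrite -ee xy // eqxx.
have [->//|xe] := ct_laminar tree en e0n ee0 xS.
have [ye|ye] := ct_laminar tree en e0n ee0 yS; first by rewrite xy // ye.
by move: sep; rewrite xe ye eqxx.
Qed.

(* Joining [c] to [s] by adding edges on the side of [s] only. *)
Lemma joined_push e0 (A : pred nat) c s : e0 < n -> c = a e0 \/ c = b e0 -> s \in S ->
  exists B : pred nat,
    [/\ forall e, A e -> B e, joined n chi B c s &
        forall x, x \in S -> chi e0 x != chi e0 s ->
          joined n chi B c x -> joined n chi A c x].
Proof.
move=> e0n cab sS.
have ce e : e < n -> e != e0 -> chi e c = chi e (a e0).
  by move=> en ee0; case: cab => -> //; rewrite (ct_other tree e0n en ee0).
(* All edges on the side of [s] are added, and [e0] itself only when [c] is its end away from [s]. A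
   path from [c] to the far side uses none of the added edges: it leaves the side of [s] at once, if
   it starts there at all. *)
exists (fun e => A e || (if e == e0 then chi e0 c != chi e0 s
                         else chi e0 (a e) == chi e0 s)).
split=> [e ->//|e en|x xS xs h e en Ae].
  rewrite negb_or => /andP[_]; case: eqP => [->|/eqP ee0].
    by rewrite negbK => /eqP.
  move=> h; rewrite ce //; have [->//|se] := ct_laminar tree en e0n ee0 sS.
  by move: h; rewrite -se eqxx.
have [ee|ee0] := eqVneq e e0.
  subst e; have [eqc|neqc] := boolP (chi e0 c == chi e0 s).
    by apply: h; rewrite // (negPf Ae) /= eqxx eqc.
  exact: (bool_neqP neqc xs).
have [eqa|neqa] := boolP (chi e0 (a e) == chi e0 s).
  rewrite ce //; have [->//|xe] := ct_laminar tree en e0n ee0 xS.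
  by move: xs; rewrite xe eqa.
by apply: h; rewrite // (negPf Ae) /= (negPf ee0).
Qed.

(* The edge at [j] on the path from [j] to [h]: the separating cut whose side
   containing [j] is smallest. *)
Lemma first_edge h j : h \in S -> j \in S -> h != j ->
  exists e0, [/\ e0 < n, chi e0 h != chi e0 j & a e0 = j \/ b e0 = j].
Proof.
move=> hS jS hj.
pose side e := #|[set x in S | chi e x == chi e j]|.
have [e1 e1P] : exists e : 'I_n, chi e h != chi e j.
  apply/existsP; apply: contraR hj; rewrite negb_exists => /forallP hh.
  apply/eqP; apply: (ct_points tree hS jS) => e en.
  by move: (hh (Ordinal en)); rewrite negbK => /eqP.
case: (@arg_minnP _ e1 (fun e : 'I_n => chi e h != chi e j) side e1P) => e0 sep emin.
exists e0; split=> //.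
have [c [cab cj cS]] : exists c, [/\ c = a e0 \/ c = b e0, chi e0 c = chi e0 j & c \in S].
  have [ea|na] := eqVneq (chi e0 (a e0)) (chi e0 j).
    by exists (a e0); split=> //; [left | exact: (ct_memL tree)].
  exists (b e0); split; [by right| |exact: (ct_memR tree)].
  have := ct_cut tree (ltn_ord e0); move: na.
  by case: (chi e0 (a e0)) (chi e0 j) (chi e0 (b e0)) => [] [] [].
suff <- : c = j by case: cab => ->; [left | right].
(* An edge [e] separating [c] from [j] would also separate [h] from [j], and its side of [j] would
   be strictly smaller, since it lies within that of [e0] and misses [c]. *)
apply: (ct_points tree cS jS) => e en; apply/eqP/contraT => ne.
have ee0 : e != e0 by apply: contra ne => /eqP ->; rewrite cj.
have ce : chi e c = chi e (a e0).
  by case: cab => -> //; rewrite (ct_other tree (ltn_ord e0) en ee0).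
have je : chi e0 j = chi e0 (a e).
  have [je|//] := ct_laminar tree en (ltn_ord e0) ee0 jS.
  by move: ne; rewrite ce je eqxx.
have he : chi e h = chi e c.
  have [->//|he] := ct_laminar tree en (ltn_ord e0) ee0 hS.
  by move: sep; rewrite he je eqxx.
have /(emin (Ordinal en)) : chi e h != chi e j by rewrite he.
rewrite leqNgt => /negP[]; apply: proper_card; apply/properP; split.
  apply/subsetP => x; rewrite !inE /= => /andP[xS xj]; rewrite xS /=.
  have [xe|->] := ct_laminar tree en (ltn_ord e0) ee0 xS; last by rewrite je.
  by move: ne; rewrite ce -xe xj.
by exists c; rewrite !inE cS ?cj //= ?(negPf ne).
Qed.

End Fixed.

(** Composed with [relocate i c], a cut of the old points extends to [i], which is put on the side
    of [c]. *)
Definition relocate i c x := if x == i then c else x.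

Lemma cut_tree_attach S n chi a b i j : i \in S -> j \in S -> j != i ->
  cut_tree (S :\ i) n chi a b ->
  cut_tree S n.+1 (fun e x => if e == n then x == i else chi e (relocate i j x))
    (fun e => if e == n then i else a e) (fun e => if e == n then j else b e).
Proof.
move=> iS jS ji tree; set r := relocate i j.
have rS x : x \in S -> r x \in S :\ i.
  by rewrite /r /relocate => xS; case: eqP => [_|/eqP xi]; rewrite !inE ?ji ?xi.
have rid x : x \in S :\ i -> r x = x.
  by rewrite /r /relocate !inE => /andP[/negPf ->].
have lt e : e < n.+1 -> e != n -> e < n by move=> ? ?; lia.
have ai e : e < n -> a e != i by move=> en; have := ct_memL tree en; rewrite !inE => /andP[].
have bi e : e < n -> b e != i by move=> en; have := ct_memR tree en; rewrite !inE => /andP[].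
have ra e : e < n -> r (a e) = a e by move=> /(ct_memL tree)/rid.
have rb e : e < n -> r (b e) = b e by move=> /(ct_memR tree)/rid.
have ri : r i = j by rewrite /r /relocate eqxx.
have rj : r j = j by rewrite /r /relocate (negPf ji).
split.
- move=> e en; case: eqP => // /eqP ne.
  by have := ct_memL tree (lt e en ne); rewrite !inE => /andP[].
- move=> e en; case: eqP => // /eqP ne.
  by have := ct_memR tree (lt e en ne); rewrite !inE => /andP[].
- move=> e en; case: (e =P n) => [_|/eqP ne]; first by rewrite eqxx (negPf ji).
  by rewrite ra ?rb ?lt //; apply: (ct_cut tree); exact: lt.
- move=> e f en fn fe; have [ee|ne] := eqVneq e n.
    have /negPf -> : f != n by rewrite -ee.
    by rewrite ri rj.
  have [ff|nf] := eqVneq f n.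
    by rewrite (negPf (ai _ (lt _ en ne))) (negPf (bi _ (lt _ en ne))).
  by rewrite ra ?rb ?lt //; apply: (ct_other tree); rewrite // lt.
- move=> e f en fn ef x xS; have [ee|ne] := eqVneq e n.
    have [ff|nf] := eqVneq f n; first by move: ef; rewrite ee ff eqxx.
    have [xi|xi] := boolP (x == i).
      by right; rewrite (eqP xi).
    by left; apply/esym/negbTE/ai/lt.
  have [ff|nf] := eqVneq f n.
    have [xi|xi] := boolP (x == i).
      by left; rewrite (eqP xi).
    by right; apply/esym/negbTE/ai/lt.
  rewrite !ra ?lt //; apply: (ct_laminar tree); rewrite ?lt ?rS //.
move=> x y xS yS h.
have := h n (ltnSn n); rewrite eqxx => xy.
have : r x = r y.
  apply: (ct_points tree (rS _ xS) (rS _ yS)) => e en.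
  by have := h e (ltnW en); rewrite (ltn_eqF en).
move: xy; rewrite /r /relocate; case: eqP => [->|_]; case: eqP => // ->//.
Qed.

(** The half from [a e0] to [i] gets the new number [n]; the half from [i] to [b e0] keeps the
    number [e0]. Each half induces the old cut of [e0], with [i] on the side of [b e0] in the first
    case and of [a e0] in the second. *)
Lemma cut_tree_subdivide S n chi a b i e0 : i \in S -> e0 < n ->
  cut_tree (S :\ i) n chi a b ->
  cut_tree S n.+1
    (fun e x => if e == n then chi e0 (relocate i (b e0) x)
                else chi e (relocate i (a e0) x))
    (fun e => if e == n then a e0 else if e == e0 then i else a e)
    (fun e => if e == n then i else b e).
Proof.
move=> iS e0n tree; set r := relocate i.
have aS := ct_memL tree; have bS := ct_memR tree.
have rS c x : c \in S :\ i -> x \in S -> r c x \in S :\ i.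
  by rewrite /r /relocate => cS xS; case: eqP => [_|/eqP xi] //; rewrite !inE xi.
have rid c x : x \in S :\ i -> r c x = x.
  by rewrite /r /relocate !inE => /andP[/negPf ->].
have ri c : r c i = c by rewrite /r /relocate eqxx.
have lt e : e < n.+1 -> e != n -> e < n by move=> ? ?; lia.
have sub x : x \in S :\ i -> x \in S by rewrite inE => /andP[].
have ra c e : e < n -> r c (a e) = a e by move=> /aS/rid.
have rb c e : e < n -> r c (b e) = b e by move=> /bS/rid.
have e0n' : e0 == n = false by apply: ltn_eqF.
have cut0 := ct_cut tree e0n.
split.
- move=> e en; case: eqP => [_|/eqP ne]; first exact/sub/aS.
  by case: eqP => // _; exact/sub/aS/lt.
- move=> e en; case: eqP => // /eqP ne; exact/sub/bS/lt.
- move=> e en; case: (e =P n) => [_|/eqP ne]; first by rewrite ra ?ri.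
  case: (e =P e0) => [->|_]; first by rewrite ri rb.
  by rewrite ra ?rb ?lt //; apply: (ct_cut tree); rewrite lt.
- move=> e f en fn fe; have [ee|ne] := eqVneq e n.
    subst e; rewrite (negPf fe) ri ra //.
  have [ff|nf] := eqVneq f n.
    case: eqP => [->|/eqP ne0]; first by rewrite ri rb.
    rewrite ra ?rb ?lt //; apply: (ct_other tree (lt _ en ne) e0n).
    by rewrite eq_sym.
  have [ee0|ne0] := eqVneq e e0.
    by rewrite ee0 in fe *; rewrite ri rb //; exact: (ct_other tree e0n (lt _ fn nf) fe).
  by rewrite ra ?rb ?lt //; exact: (ct_other tree (lt _ en ne) (lt _ fn nf) fe).
- have key x : x \in S ->
     chi e0 (r (b e0) x) = chi e0 (b e0) \/ chi e0 (r (a e0) x) = chi e0 (a e0).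
    rewrite /r /relocate; case: eqP => _ xS; first by left.
    have [xa|xa] := eqVneq (chi e0 x) (chi e0 (a e0)); first by right.
    by left; apply: bool_neqP xa _; rewrite eq_sym.
  have rab f x : f < n -> f != e0 -> chi f (r (b e0) x) = chi f (r (a e0) x).
    by move=> fn fe; rewrite /r /relocate; case: eqP => // _; rewrite (ct_other tree e0n fn fe).
  have lam e f x : e < n -> f < n -> e != f -> x \in S ->
      chi e (r (a e0) x) = chi e (a f) \/ chi f (r (a e0) x) = chi f (a e).
    by move=> en fn ef xS; apply: (ct_laminar tree en fn ef); apply: rS; rewrite ?aS.
  have lamb f x : f < n -> f != e0 -> x \in S ->
      chi e0 (r (b e0) x) = chi e0 (a f) \/ chi f (r (a e0) x) = chi f (a e0).
    move=> fn fe xS; rewrite -rab //; apply: (ct_laminar tree e0n fn).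
      by rewrite eq_sym.
    by apply: rS; rewrite ?bS.
  move=> e f en fn ef x xS; have [ee|ne] := eqVneq e n.
    subst e; have fn' : f < n by rewrite lt // eq_sym.
    rewrite (ltn_eqF fn') ra //.
    have [->|ff] := eqVneq f e0; first by rewrite ri; exact: key.
    by rewrite ra //; exact: lamb.
  have en' := lt _ en ne.
  have [ff|nf] := eqVneq f n.
    rewrite ra //.
    have [->|ee0] := eqVneq e e0; first by rewrite ri or_comm; exact: key.
    by rewrite ra // or_comm; exact: lamb.
  have fn' := lt _ fn nf.
  have ja g h : g < n -> chi h (r (a e0) (if g == e0 then i else a g)) = chi h (a g).
    by move=> gn; case: eqP => [->|_]; rewrite ?ri ?ra.
  by rewrite !ja //; exact: lam.
move=> x y xS yS h.
have hn := h n (ltnSn n); rewrite eqxx in hn.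
have h0 := h e0 (ltnW e0n); rewrite e0n' in h0.
have he e : e < n -> chi e (r (a e0) x) = chi e (r (a e0) y).
  by move=> en; have := h e (ltnW en); rewrite (ltn_eqF en).
have := ct_points tree (rS _ _ (aS _ e0n) xS) (rS _ _ (aS _ e0n) yS) he.
move: hn h0; rewrite /r /relocate; case: eqP => [->|_]; case: eqP => [->|_] // hn h0 _.
  by move: cut0; rewrite h0 hn eqxx.
by move: cut0; rewrite -h0 -hn eqxx.
Qed.

End Cuts.

(** * Adding a point to a tree *)

Section Extension.
Context {T : finType} (pos : T -> nat).
Hypothesis pos_inj : injective pos.
Implicit Types (x y z w i j c : T) (S V : {set T}) (R : T -> T -> Prop).

Local Notation cyc := (cyc_order pos).

Definition good S V R := noncross pos S R /\ flat pos S V R.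

(* [R'] extends [R] to a new point [i], which is either put in the class of
   [c] or kept isolated. *)
Definition extends i c (K : bool) R R' : Prop :=
  forall x y, R' x y <->
    R (relocate i c x) (relocate i c y) /\ (K || ((x == i) == (y == i))).

Section Extends.
Context {i c : T} {K : bool} {R R' : T -> T -> Prop}.
Hypotheses (R'P : extends i c K R R') (eqR : equiv R).

Lemma extends_old x y : x != i -> y != i -> R' x y <-> R x y.
Proof.
move=> xi yi; rewrite (R'P x y) /relocate (negPf xi) (negPf yi) eqxx orbT.
by split=> [[]|].
Qed.

Lemma extends_new y : y != i -> R' i y <-> K /\ R c y.
Proof.
move=> yi; rewrite (R'P i y) /relocate (negPf yi) eqxx orbF.
by split=> [[]|[]].
Qed.

Lemma extends_equiv : equiv R'.
Proof.
have [rR sR tR] := eqR; split=> [x|x y|x y z].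
- by apply/(R'P x x); rewrite eqxx orbT; split.
- by move=> /(R'P x y)[h k]; apply/(R'P y x); split; [exact: sR | rewrite [_ == (x == i)]eq_sym].
- move=> /(R'P x y)[h k] /(R'P y z)[h' k']; apply/(R'P x z); split.
    exact: tR h h'.
  by move: k k'; case: K => //= /eqP -> /eqP ->.
Qed.

End Extends.

(** By adjacency, [j] can replace [i] in cyclic relations with two further points, which settles
    crossings at [i] and arcs ending at [i]. No arc free of [V] passes through the extreme point
    [i], and an arc between other points that avoids [i] avoids [j] too, so treating [j] as extreme
    in the smaller set costs nothing. The remaining case, the long arc between [i] and [j], is
    excluded by the third extreme point. *)
Lemma good_attach S V i j K R R' :
  i \in S -> i \in V -> j \in S -> j != i -> adjacent pos S i j ->
  (forall w, w \in S -> w != i -> w != j ->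
     exists v, [/\ v \in S, v \in V, v != i & v != j]) ->
  equiv R -> extends i j K R R' ->
  good (S :\ i) (j |: V :\ i) R -> good S V R'.
Proof.
move=> iS iV jS ji adj hV eqR R'P [nc fl].
have eqR' := extends_equiv R'P eqR.
have [rR sR tR] := eqR; have [rR' sR' tR'] := eqR'.
have mem x : x \in S -> x != i -> x \in S :\ i by move=> ? ?; rewrite !inE; apply/andP.
have jS' := mem j jS ji.
split.
  apply: (noncross_rec eqR' iS).
    move=> a b c d aS bS cS dS h1 h2 ac bd.
    have ni x : x \in S :\ i -> x != i by rewrite !inE => /andP[].
    move/(extends_old R'P (ni _ aS) (ni _ cS)): ac => ac.
    move/(extends_old R'P (ni _ bS) (ni _ dS)): bd => bd.
    by apply/(extends_old R'P (ni _ aS) (ni _ bS)); exact: (nc a b c d).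
  move=> b c d /[dup] bS' /setD1P[bi bS] /[dup] cS' /setD1P[ci cS].
  move=> /[dup] dS' /setD1P[di dS] h1 h2 /(extends_new R'P ci)[k jc].
  move/(extends_old R'P bi di) => bd; apply/(extends_new R'P bi); split=> //.
  have [->|bj] := eqVneq b j; first exact: rR.
  have [dj|dj] := eqVneq d j; first by apply: (sR _ _); rewrite -dj.
  have [cj|cj] := eqVneq c j.
    have := adj b d bS dS bi di bj dj.
    by move: h1 h2; rewrite cj; cyc_lia.
  apply: (nc j b c d) => //.
    by rewrite -(adj b c).
  have := adj c d cS dS ci di cj dj; move: h2; cyc_lia.
move=> u v uS vS uv arc w wS uwv.
have [uw wv vu] := cyc_neq uwv.
have wi : w != i by apply: contraL iV => /eqP <-; exact: arc.
have iuv : ~~ cyc u i v by apply: contraL iV; exact: arc.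
have [ui|ui] := eqVneq u i.
  subst u; have [k jv] := (extends_new R'P vu).1 uv.
  apply/(extends_new R'P wi); split=> //.
  have [->|wj] := eqVneq w j; first exact: rR.
  have [vj|vj] := eqVneq v j.
    have [t [tS tV ti tj]] := hV w wS wi wj.
    have := arc t tS; rewrite tV vj.
    move/(pos_neq pos_inj): (wj); move/(pos_neq pos_inj): (tj).
    have := adj w t wS tS wi ti wj tj; have := adj t w tS wS ti wi tj wj.
    move/(pos_neq pos_inj): (ti).
    move: uwv; rewrite vj; case E : (cyc i t j); first by move=> ? ? ? ? ? ? /(_ isT).
    by move: E; cyc_lia.
  apply: (fl j v jS' (mem v vS vu)) => //.
  - move=> x /setD1P[xi xS] cx; have [jx xv _] := cyc_neq cx.
    rewrite !inE (negPf xi) eq_sym (negPf jx) /=; apply: arc => //.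
    by rewrite (adj x v) // eq_sym.
  - exact: mem.
  - by rewrite -(adj w v).
have [vi|vi] := eqVneq v i.
  subst v; have [k ju] := (extends_new R'P ui).1 (sR' _ _ uv).
  apply: (tR' _ _ _ uv); apply/(extends_new R'P wi); split=> //.
  have [->|wj] := eqVneq w j; first exact: rR.
  have [uj|uj] := eqVneq u j.
    have [t [tS tV ti tj]] := hV w wS wi wj.
    have := arc t tS; rewrite tV uj.
    move/(pos_neq pos_inj): (wj); move/(pos_neq pos_inj): (tj).
    have := adj w t wS tS wi ti wj tj; have := adj t w tS wS ti wi tj wj.
    move/(pos_neq pos_inj): (ti).
    move: uwv; rewrite uj; case E : (cyc j t i); first by move=> ? ? ? ? ? ? /(_ isT).
    by move: E; cyc_lia.
  have rot x y z : cyc x y z = cyc z x y by cyc_lia.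
  apply: (tR _ _ _ ju); apply: (fl u j (mem u uS ui) jS') => //.
  - exact: sR.
  - move=> x /setD1P[xi xS] cx; have [ux xj _] := cyc_neq cx.
    rewrite !inE (negPf xi) (negPf xj) /=; apply: arc => //.
    by rewrite rot (adj u x) // -rot.
  - exact: mem.
  - by rewrite rot -(adj u w) // -rot.
apply/(extends_old R'P ui wi); apply: (fl u v (mem u uS ui) (mem v vS vi)) => //.
- exact/(extends_old R'P ui vi).
- move=> x /setD1P[xi xS] cx; rewrite !inE (negPf xi) /= negb_or arc // andbT.
  apply/eqP => xj; subst x; have [uj jv _] := cyc_neq cx.
  have rot x y z : cyc x y z = cyc y z x by cyc_lia.
  by move/negP: iuv; apply; rewrite rot (adj v u) // 1?eq_sym // -rot.
- exact: mem.
Qed.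

Section Subdivision.
Context {S V : {set T}} {n : nat} {chi : nat -> T -> bool} {a b : nat -> T}.
Context {i h j : T} {e0 : nat}.
Hypothesis tree : cut_tree (S :\ i) n chi a b.
Hypotheses (iS : i \in S) (hS : h \in S) (jS : j \in S) (hi : h != i) (ji : j != i).
Hypothesis pred_h : forall w, w \in S -> ~~ cyc h w i.
Hypothesis succ_j : forall w, w \in S -> ~~ cyc i w j.
Hypotheses (e0n : e0 < n) (sep : chi e0 h != chi e0 j).
Hypothesis V2 : forall x, exists v, [/\ v \in S, v \in V, v != i & v != x].
Hypothesis good_joined : forall A : pred nat, good (S :\ i) V (joined n chi A).

(** The neighbours [h] and [j] lie on different sides of [e0]. For the class of the new point,
    [joined_push] enlarges [A] on one side so that the neighbour there joins this class; goodness of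
    the enlarged edge set is applied to that old point, and the result is pulled back on the other
    side. *)
Lemma good_subdivide (A : pred nat) c K R' : c = a e0 \/ c = b e0 ->
  (K = false -> ~~ A e0) ->
  extends i c K (joined n chi A) R' -> good S V R'.
Proof.
move=> cab KA R'P.
have eqR := joined_equiv n chi A.
have eqR' := extends_equiv R'P eqR.
have [rR sR tR] := eqR; have [rR' sR' tR'] := eqR'.
have mem x : x \in S -> x != i -> x \in S :\ i by move=> ? ?; rewrite !inE; apply/andP.
have hS' := mem h hS hi; have jS' := mem j jS ji.
have hj : h != j by apply: contra sep => /eqP ->.
have adj_j := succ_adjacent pos_inj iS jS ji succ_j.
have adj_h : adjacent pos S i h.
  by apply: adjacent_sym; apply: succ_adjacent; rewrite // eq_sym.
have [nc fl] := good_joined A.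
have cS : c \in S :\ i by case: cab => ->; [exact: (ct_memL tree) | exact: (ct_memR tree)].
have cross x y : x \in S :\ i -> y \in S :\ i -> joined n chi A x y ->
    chi e0 x != chi e0 y -> joined n chi A c x.
  move=> xS yS xy xy0; have ax := joined_end tree e0n xS yS xy xy0.
  case: cab => -> // e en Ae; have [ee|ee0] := eqVneq e e0.
    by move: xy0; rewrite -ee xy // eqxx.
  by rewrite -(ct_other tree e0n en ee0) ax.
split.
  apply: (noncross_rec eqR' iS).
    move=> x y z t xS yS zS tS h1 h2 xz yt.
    have ni w : w \in S :\ i -> w != i by rewrite !inE => /andP[].
    move/(extends_old R'P (ni _ xS) (ni _ zS)): xz => xz.
    move/(extends_old R'P (ni _ yS) (ni _ tS)): yt => yt.
    by apply/(extends_old R'P (ni _ xS) (ni _ yS)); exact: (nc x y z t).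
  move=> p q r /[dup] pS' /setD1P[pi pS] /[dup] qS' /setD1P[qi qS].
  move=> /[dup] rS' /setD1P[ri rS] h1 h2 /(extends_new R'P qi)[k cq].
  move/(extends_old R'P pi ri) => pr; apply/(extends_new R'P pi); split=> //.
  have [pr0|pr0] := boolP (chi e0 p != chi e0 r); first exact: cross pr pr0.
  move: pr0; rewrite negbK => /eqP pr0.
  (* [s] is the neighbour of [i] across [e0] from [p]. Over [B] it is linked to [c] and stands in
     for [i] in the crossing; since [p] is on the opposite side, the link from [c] to [p] found over
     [B] already exists over [A]. *)
  have [s [sS' si ps adj_s]] : exists s, [/\ s \in S :\ i, s != i, chi e0 p != chi e0 s & adjacent pos S i s].
    have [ph|ph] := eqVneq (chi e0 p) (chi e0 h); last by exists h; split.
    by exists j; split=> //; rewrite ph.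
  have sS : s \in S by case/setD1P: sS'.
  have [B [AB cs back]] := joined_push tree A e0n cab sS'.
  apply: back => //.
  have [ncB _] := good_joined B.
  have [_ sB tB] := joined_equiv n chi B.
  apply: (tB _ _ _ cs).
  have ps' : p != s by apply: contra ps => /eqP ->.
  have rs' : r != s by apply: contra ps; rewrite pr0 => /eqP ->.
  have [qs|qs] := eqVneq q s.
    have := adj_s p r pS rS pi ri ps' rs'.
    by move: h1 h2; rewrite qs; cyc_lia.
  apply: (ncB s p q r) => //.
  - by rewrite -(adj_s p q).
  - have := adj_s q r qS rS qi ri qs rs'; move: h2; cyc_lia.
  - apply: (tB _ _ _ (sB _ _ cs)); exact: joined_sub cq.
  - exact: joined_sub pr.
move=> u v uS vS uv arc w wS uwv.
have [uw wv vu] := cyc_neq uwv.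
have [ui|ui] := eqVneq u i.
  subst u; have [k cv] := (extends_new R'P vu).1 uv.
  have wi : w != i by rewrite eq_sym.
  apply/(extends_new R'P wi); split=> //.
  have vj : v != j by apply: contraL uwv => /eqP ->; exact: succ_j.
  (* The arc from [i] to its predecessor [h] passes all other points, one of which is extreme. *)
  have hv : v != h.
    apply/eqP => vh; have [t [tS tV ti th]] := V2 h.
    have := arc t tS; rewrite tV vh => /implyP; rewrite implybF => /negP; apply.
    have := pred_h tS; move/(pos_neq pos_inj): ti; move/(pos_neq pos_inj): th.
    by move/(pos_neq pos_inj): hi; cyc_lia.
  (* Over [B] the class of [i] contains [h], and flatness on the arc from [h] to [v] yields [j]. As
     [j] is across [e0] from [h], it is linked to [c] over [A], and the rest of the arc is handled
     from [j]. *)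
  have [B [AB ch back]] := joined_push tree A e0n cab hS'.
  have [_ sB tB] := joined_equiv n chi B.
  have [_ flB] := good_joined B.
  have cj : joined n chi A c j.
    apply: back => //; first by rewrite eq_sym.
    apply: (tB _ _ _ ch); apply: (flB h v hS' (mem v vS vu)) => //.
    + apply: (tB _ _ _ (sB _ _ ch)); exact: joined_sub cv.
    + move=> x /setD1P[xi xS] cx; apply: arc => //.
      by have := pred_h xS; move/(pos_neq pos_inj): (hi); move/(pos_neq pos_inj): xi;
        move: cx; cyc_lia.
    + have := succ_j vS; have := pred_h jS; have := pred_h vS.
      move/(pos_neq pos_inj): (hi); move/(pos_neq pos_inj): (ji).
      move/(pos_neq pos_inj): (hj); move/(pos_neq pos_inj): (hv).
      move/(pos_neq pos_inj): (vj); move/(pos_neq pos_inj): (vu).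
      by cyc_lia.
  have [->//|wj] := eqVneq w j.
  apply: (tR _ _ _ cj); apply: (fl j v jS' (mem v vS vu)) => //.
  + exact: (tR _ _ _ (sR _ _ cj) cv).
  + move=> x /setD1P[xi xS] cx; apply: arc => //.
    by move: cx; have := succ_j vS; move/(pos_neq pos_inj): (ji);
      move/(pos_neq pos_inj): (vu); cyc_lia.
  + exact: mem.
  + have := succ_j wS; move: uwv; move/(pos_neq pos_inj): (wj).
    by cyc_lia.
have [vi|vi] := eqVneq v i.
  subst v; have [k cu] := (extends_new R'P ui).1 (sR' _ _ uv).
  apply: (tR' _ _ _ uv); apply/(extends_new R'P wv); split=> //.
  have uh : u != h by apply: contraL uwv => /eqP ->; exact: pred_h.
  have uj : u != j.
    apply/eqP => uj; have [t [tS tV ti tj]] := V2 j.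
    have := arc t tS; rewrite tV uj => /implyP; rewrite implybF => /negP; apply.
    have := succ_j tS; move/(pos_neq pos_inj): ti; move/(pos_neq pos_inj): tj.
    by move/(pos_neq pos_inj): ji; cyc_lia.
  have [B [AB ch back]] := joined_push tree A e0n cab jS'.
  have [_ sB tB] := joined_equiv n chi B.
  have [_ flB] := good_joined B.
  have bu : joined n chi B j u by apply: (tB _ _ _ (sB _ _ ch)); exact: joined_sub cu.
  have cj : joined n chi A c h.
    apply: back => //.
    apply: (tB _ _ _ ch); apply: (tB _ _ _ bu); apply: (flB u j (mem u uS ui) jS') => //.
    + exact: sB.
    + move=> x /setD1P[xi xS] cx; apply: arc => //.
      by have := succ_j xS; move/(pos_neq pos_inj): (ji); move/(pos_neq pos_inj): xi;
        move: cx; cyc_lia.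
    + have := succ_j uS; have := succ_j hS; have := pred_h uS.
      move/(pos_neq pos_inj): (hi); move/(pos_neq pos_inj): (ji).
      move/(pos_neq pos_inj): (hj); move/(pos_neq pos_inj): (uh).
      move/(pos_neq pos_inj): (uj); move/(pos_neq pos_inj): (ui).
      by cyc_lia.
  have [->//|wh] := eqVneq w h.
  apply: (tR _ _ _ cu); apply: (fl u h (mem u uS ui) hS') => //.
  + exact: (tR _ _ _ (sR _ _ cu) cj).
  + move=> x /setD1P[xi xS] cx; apply: arc => //.
    by move: cx; have := pred_h uS; move/(pos_neq pos_inj): (hi);
      move/(pos_neq pos_inj): (ui); cyc_lia.
  + exact: mem.
  + have := pred_h wS; move: uwv; move/(pos_neq pos_inj): (wh).
    by cyc_lia.
have uvA := (extends_old R'P ui vi).1 uv.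
have old x : x \in S -> x != i -> cyc u x v -> joined n chi A u x.
  move=> xS xi cx; apply: (fl u v (mem u uS ui) (mem v vS vi)) => //.
    by move=> y /setD1P[yi yS]; exact: arc.
  exact: mem.
have [wi|wi] := eqVneq w i; last by apply/(extends_old R'P ui wi); exact: old.
subst w.
have uh : joined n chi A u h.
  have [->|uh] := eqVneq u h; first exact: rR.
  apply: old => //; have := pred_h uS; move: uwv; move/(pos_neq pos_inj): uh.
  by have := pred_h vS; move/(pos_neq pos_inj): hi; cyc_lia.
have vj : joined n chi A u j.
  have [<-//|vj] := eqVneq v j.
  apply: old => //; have := succ_j uS; move: uwv; move/(pos_neq pos_inj): vj.
  by have := succ_j vS; move/(pos_neq pos_inj): ji; cyc_lia.
(* A link between [h] and [j] must use [e0]. So [e0] is in [A], which forces [K], and the end [c] of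
   [e0] is in their class. *)
have hjA := tR _ _ _ (sR _ _ uh) vj.
apply: (sR' _ _); apply/(extends_new R'P ui); split.
  by apply: contraT => /negbTE /KA Ae0; move: sep; rewrite (hjA e0) // eqxx.
exact: tR (cross _ _ hS' jS' hjA sep) (sR _ _ uh).
Qed.

End Subdivision.
End Extension.

(** * Extending a tree together with the edge set of the given partition *)

Section TreeExistence.
Context {T : finType} (pos : T -> nat) {C : eqType} (col : T -> C).
Hypothesis pos_inj : injective pos.
Implicit Types (x y z w i j c : T) (S V : {set T}).

Local Notation cyc := (cyc_order pos).
Local Notation same := (fun x y => col x = col y).

(** The given partition is recorded by the colouring [col] of the whole type, which stays fixed
    while [S] shrinks; [n] is the number of edges. *)
Definition tree_exists n S V : Prop :=
  exists chi a b (A0 : pred nat),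
    [/\ cut_tree S n chi a b,
        forall A : pred nat, good pos S V (joined n chi A) &
        forall x y, x \in S -> y \in S -> col x = col y <-> joined n chi A0 x y].

Lemma extends_attach n chi i j (A : pred nat) :
  extends i j (A n) (joined n chi A)
    (joined n.+1 (fun e x => if e == n then x == i else chi e (relocate i j x)) A).
Proof.
move=> x y; split=> [h|[h k] e en Ae].
  split=> [e en Ae|]; first by have := h e (ltnW en) Ae; rewrite (ltn_eqF en).
  by have := h n (ltnSn n); rewrite eqxx; case: (A n) => //= ->.
have [ee|ne] := eqVneq e n; last by apply: h; rewrite // ltn_neqAle ne -ltnS.
by move: k Ae; rewrite ee; case: (A n) => //= /eqP.
Qed.

Lemma extends_subdivide S n chi a b i e0 (A : pred nat) :
  cut_tree (S :\ i) n chi a b -> e0 < n -> 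
  exists c K (B : pred nat), [/\ c = a e0 \/ c = b e0, K = false -> ~~ B e0 &
  extends i c K (joined n chi B)
    (joined n.+1 (fun e x => if e == n then chi e0 (relocate i (b e0) x)
                else chi e (relocate i (a e0) x)) A)].
Proof.
move=> tree e0n.
(* The old edge counts as present when both halves are. If just one half is present, [c] is the end
   to which it links [i]; if both are, either end would do. *)
pose B : pred nat := fun e => A e && ((e != e0) || A n).
pose c := if A e0 && ~~ A n then b e0 else a e0.
exists c, (A e0 || A n), B; split.
- by rewrite /c; case: ifP => _; [right | left].
- by rewrite /B; case: (A e0).
have cut0 := ct_cut tree e0n.
have other e x : e < n -> e != e0 -> chi e (relocate i c x) = chi e (relocate i (a e0) x).
  move=> en ne; rewrite /relocate; case: eqP => // _; rewrite /c; case: ifP => // _.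
  by rewrite (ct_other tree e0n en ne).
move=> x y; split=> [h|[h k] e en Ae].
  have h0 : ~~ A e0 -> chi e0 (relocate i (a e0) x) = chi e0 (relocate i (a e0) y).
    by move=> Ae; have := h e0 (ltnW e0n) Ae; rewrite (ltn_eqF e0n).
  have hn : ~~ A n -> chi e0 (relocate i (b e0) x) = chi e0 (relocate i (b e0) y).
    by move=> Ae; have := h n (ltnSn n) Ae; rewrite eqxx.
  split=> [e en Be|].
    have [ee|ne] := eqVneq e e0.
      subst e; move: Be; rewrite /B eqxx /= /c.
      by case: (A e0) h0 (A n) hn => [] h0 [] //= hn _; auto.
    rewrite !other //; have := h e (ltnW en); rewrite (ltn_eqF en); apply.
    by move: Be; rewrite /B ne andbT.
  case: (A e0) h0 (A n) hn => //= h0 [] //= hn.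
  have := h0 isT; have := hn isT; rewrite /relocate.
  case: (x == i); case: (y == i) => // h1 h2; move: cut0.
    by rewrite h1 h2 eqxx.
  by rewrite -h1 -h2 eqxx.
have rr d d' : (x == i) = (y == i) ->
    chi e0 (relocate i d' x) = chi e0 (relocate i d' y) ->
    chi e0 (relocate i d x) = chi e0 (relocate i d y).
  by rewrite /relocate; case: (x == i) => <-.
have [ee|ne] := eqVneq e n.
  subst e; have : ~~ B e0 by rewrite /B eqxx (negPf Ae) andbF.
  move=> /(h e0 e0n); move: k; rewrite /c (negPf Ae) orbF /=.
  by case: (A e0) => //= /eqP; exact: rr.
have en' : e < n by rewrite ltn_neqAle ne -ltnS.
have [ee|ne0] := eqVneq e e0.
  subst e; have : ~~ B e0 by rewrite /B (negPf Ae).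
  by move=> /(h e0 e0n); rewrite /c (negPf Ae).
by rewrite -!other //; apply: h => //; rewrite /B (negPf Ae).
Qed.

Lemma tree_attach n S V i j : i \in S -> i \in V -> j \in S -> j != i ->
  #|S| = n.+2 -> adjacent pos S i j ->
  (0 < n -> 1 < #|j |: V :\ i|) -> V \subset S ->
  (col i = col j \/ forall x, x \in S -> x != i -> col i <> col x) ->
  tree_exists n (S :\ i) (j |: V :\ i) -> tree_exists n.+1 S V.
Proof.
move=> iS iV jS ji cardS adj V2 VS coli [chi [a [b [A0 [tree gd colE]]]]].
pose A1 : pred nat := fun e => if e == n then col i == col j else A0 e.
exists (fun e x => if e == n then x == i else chi e (relocate i j x)).
exists (fun e => if e == n then i else a e), (fun e => if e == n then j else b e), A1.
split; first exact: cut_tree_attach.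
  move=> A; apply: (good_attach pos_inj iS iV jS ji adj) (gd A); last exact: extends_attach.
    move=> w wS wi wj; have n0 : 0 < n.
      have : #|[set i; j; w]| <= #|S|.
        by apply: subset_leq_card; apply/subsetP => x; rewrite !inE => /orP[/orP[]|] /eqP ->.
      rewrite cardS -setUA cardsU1 cards2 !inE negb_or ![i == _]eq_sym ji wi.
      by rewrite eq_sym wj.
    have := V2 n0; rewrite (cardsD1 j) !inE eqxx /= ltnS => /card_gt0P[v].
    rewrite !inE => /andP[vj]; rewrite (negPf vj) /= => /andP[vi vV].
    exists v; split=> //.
    exact: (subsetP VS).
  exact: joined_equiv.
have mem x : x \in S -> x != i -> x \in S :\ i by move=> ? ?; rewrite !inE; apply/andP.
have jS' := mem j jS ji.
have ext := @extends_attach n chi i j A1.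
have jA x y : joined n chi A1 x y <-> joined n chi A0 x y.
  by split=> h e en; have := h e en; rewrite /A1 (ltn_eqF en).
have A1n : A1 n = (col i == col j) by rewrite /A1 eqxx.
have eqv := extends_equiv ext (joined_equiv n chi A1).
have [r s t] := eqv.
have key y : y \in S -> y != i -> col i = col y <->
    joined n.+1 (fun e x => if e == n then x == i else chi e (relocate i j x)) A1 i y.
  move=> yS yi; rewrite (extends_new ext yi) A1n jA -colE ?mem //.
  case: coli => [e|ne]; first by rewrite e eqxx; split=> [|[]].
  by split=> [/(ne y yS yi)//|[/eqP/(ne j jS ji)]].
move=> x y xS yS.
have [xi|xi] := eqVneq x i.
  subst x; have [yi|yi] := eqVneq y i; first by subst y; split.
  exact: key.
have [yi|yi] := eqVneq y i.
  by subst y; split=> [/esym/(key x xS xi)/s|/s/(key x xS xi)/esym].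
by rewrite (extends_old ext xi yi) jA -colE ?mem.
Qed.

(** The edge to subdivide must separate [h] from [j]. If [i] is a singleton, an unselected such edge
    exists because [h] and [j] have different colours, and neither half is selected. Otherwise it is
    the path edge at the neighbour sharing the colour of [i], so that selecting one half can link
    [i] to that neighbour. *)
Lemma tree_subdivide n S V i h j : i \in S -> i \notin V -> V \subset S ->
  1 < #|V| -> h \in S -> j \in S -> h != i -> j != i -> h != j ->
  (forall w, w \in S -> ~~ cyc h w i) -> (forall w, w \in S -> ~~ cyc i w j) ->
  ((forall x, x \in S -> x != i -> col i <> col x) /\ col h <> col j) \/
  (col i = col j \/ col i = col h) ->
  tree_exists n (S :\ i) V -> tree_exists n.+1 S V.
Proof.
move=> iS iV VS V2 hS jS hi ji hj predh succj coli [chi [a [b [A0 [tree gd colE]]]]].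
have mem x : x \in S -> x != i -> x \in S :\ i by move=> ? ?; rewrite !inE; apply/andP.
have hS' := mem h hS hi; have jS' := mem j jS ji.
have V2' x : exists v, [/\ v \in S, v \in V, v != i & v != x].
  have /card_gt0P[v] : 0 < #|V :\ x|.
    by move: V2; rewrite (cardsD1 x); case: (x \in V); [|exact: ltnW].
  rewrite !inE => /andP[vx vV]; exists v; split=> //; first exact: (subsetP VS).
  by apply: contraNneq iV => <-.
have [e0 [e0n sep choice]] : exists e0, [/\ e0 < n, chi e0 h != chi e0 j &
   (~~ A0 e0 /\ forall x, x \in S -> x != i -> col i <> col x) \/
   exists k, [/\ k \in S :\ i, col i = col k & k = a e0 \/ k = b e0]].
  case: coli => [[sing nhj]|[ij|ih]].
  - have /existsP[e /andP[Ae sep]] : [exists e : 'I_n, ~~ A0 e && (chi e h != chi e j)].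
      apply: contraT; rewrite negb_exists => /forallP hh; case: nhj.
      apply/(colE h j hS' jS') => e en Ae.
      by have := hh (Ordinal en); rewrite Ae /= negbK => /eqP.
    by exists e; split=> //; left.
  - have [e [en sep ab]] := first_edge tree hS' jS' hj.
    by exists e; split=> //; right; exists j; split=> //; case: ab => ->; [left|right].
  - have jh : j != h by rewrite eq_sym.
    have [e [en sep ab]] := first_edge tree jS' hS' jh.
    exists e; split=> //; first by rewrite eq_sym.
    by right; exists h; split=> //; case: ab => ->; [left|right].
have ext (A : pred nat) := extends_subdivide A tree e0n.
set chi' := (fun e x => if e == n then chi e0 (relocate i (b e0) x)
                else chi e (relocate i (a e0) x)) in ext *.
have good' (A : pred nat) : good pos S V (joined n.+1 chi' A).
  have [c [K [B [cab KB R'P]]]] := ext A.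
  exact: (good_subdivide pos_inj tree iS hS jS hi ji predh succj e0n sep V2' gd cab KB R'P).
have tree' := cut_tree_subdivide iS e0n tree.
exists chi', (fun e => if e == n then a e0 else if e == e0 then i else a e),
  (fun e => if e == n then i else b e).
suff [A1 [old new]] : exists A1 : pred nat,
   (forall x y, x != i -> y != i -> joined n.+1 chi' A1 x y <-> joined n chi A0 x y)
   /\ (forall x, x \in S -> x != i -> joined n.+1 chi' A1 i x <-> col i = col x).
  exists A1; split=> // x y xS yS; have [r s t] := joined_equiv n.+1 chi' A1.
  have [xi|xi] := eqVneq x i.
    subst x; have [yi|yi] := eqVneq y i; first by subst y; split.
    by rewrite new.
  have [yi|yi] := eqVneq y i.
    by subst y; split=> [/esym/(new x xS xi)/s|/s/(new x xS xi)/esym].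
  by rewrite old // -colE ?mem.
have oldE (A1 : pred nat) : (forall e, e < n -> e != e0 -> A1 e = A0 e) ->
    (A1 e0 && A1 n = A0 e0) ->
    forall x y, x != i -> y != i -> joined n.+1 chi' A1 x y <-> joined n chi A0 x y.
  move=> A1e A1n x y xi yi; split=> jj e en Ae.
    have [ee|ne] := eqVneq e e0.
      move: Ae; rewrite ee -A1n negb_and => /orP[] Ae.
        by have := jj e0 (ltnW e0n) Ae; rewrite /chi' (ltn_eqF e0n) /relocate (negPf xi) (negPf yi).
      by have := jj n (ltnSn n) Ae; rewrite /chi' eqxx /relocate (negPf xi) (negPf yi).
    have := jj e (ltnW en); rewrite A1e // /chi' (ltn_eqF en) /relocate (negPf xi) (negPf yi).
    exact.
  rewrite /chi' /relocate (negPf xi) (negPf yi); have [ee|ne] := eqVneq e n.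
    by apply: jj => //; rewrite -A1n -ee (negPf Ae) andbF.
  have en' : e < n by rewrite ltn_neqAle ne -ltnS.
  apply: jj => //; have [ee|ne0] := eqVneq e e0; last by rewrite -A1e.
  by rewrite ee -A1n -ee (negPf Ae).
have cut0 := ct_cut tree e0n.
case: choice => [[Ae0 sing]|[k [kS ik kab]]].
  pose A1 : pred nat := fun e => if e == n then false else A0 e.
  exists A1; split.
    apply: oldE => [e en _|]; first by rewrite /A1 (ltn_eqF en).
    by rewrite /A1 eqxx andbF (negPf Ae0).
  move=> x xS xi; split=> [jj|/sing]; last by move=> /(_ xS xi).
  have := jj n (ltnSn n); have := jj e0 (ltnW e0n).
  rewrite /A1 /chi' (ltn_eqF e0n) eqxx /relocate eqxx (negPf xi).
  by move=> /(_ Ae0) h1 /(_ isT) h2; move: cut0; rewrite h1 h2 eqxx.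
(* Both halves are selected if [e0] was; otherwise only the half towards [k], which is [n] for
   [k = a e0] and [e0] for [k = b e0]. *)
pose A1 : pred nat := fun e =>
  if e == n then A0 e0 || (k != b e0) else if e == e0 then A0 e0 || (k == b e0) else A0 e.
have A1n : A1 n = A0 e0 || (k != b e0) by rewrite /A1 eqxx.
have A1e0 : A1 e0 = A0 e0 || (k == b e0) by rewrite /A1 (ltn_eqF e0n) eqxx.
have A1e e : e < n -> e != e0 -> A1 e = A0 e.
  by move=> en ne; rewrite /A1 (ltn_eqF en) (negPf ne).
have old := oldE A1 A1e.
have A1A0 : A1 e0 && A1 n = A0 e0.
  by rewrite A1n A1e0; case: (A0 e0) => //=; rewrite andbN.
exists A1; split; first exact: old.
move=> x xS xi.
have ki : k != i by case/setD1P: kS.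
suff ik' : joined n.+1 chi' A1 i k.
  have [r s t] := joined_equiv n.+1 chi' A1.
  rewrite ik (colE k x kS (mem x xS xi)) -(old A1A0) //.
  by split=> h'; [exact: (t _ _ _ (s _ _ ik')) | exact: (t _ _ _ ik')].
move=> e en Ae; rewrite /chi' /relocate eqxx (negPf ki).
have [ee|ne] := eqVneq e n.
  move: Ae; rewrite ee A1n negb_or negbK => /andP[_ /eqP <-] //.
have en' : e < n by rewrite ltn_neqAle ne -ltnS.
have [ee|ne0] := eqVneq e e0.
  move: Ae; rewrite ee A1e0 negb_or => /andP[_ kb].
  by case: kab kb => -> //; rewrite eqxx.
by case: kab => -> //; rewrite (ct_other tree e0n en' ne0).
Qed.

End TreeExistence.

(** * Existence of the tree *)

Section TreeInduction.
Context {T : finType} (pos : T -> nat) {C : eqType} (col : T -> C).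
Hypothesis pos_inj : injective pos.
Implicit Types (x y z w i j c : T) (S V : {set T}).

Local Notation cyc := (cyc_order pos).
Local Notation same := (fun x y => col x = col y).
Local Notation neq := (pos_neq pos_inj).

Lemma noncross_sub S S' R : S' \subset S -> noncross pos S R -> noncross pos S' R.
Proof.
by move=> /subsetP sub nc a b c d /sub ? /sub ? /sub ? /sub ?; exact: nc.
Qed.

(** Among pairs of distinct points of one block, take one with the fewest points on the arc from the
    first to the second. A point [w] on that arc is a singleton: a mate on the closed arc gives a
    shorter arc, and a mate beyond it makes a crossing that puts [w] into the block of the ends. *)
Lemma adjacent_or_singleton S : noncross pos S same -> 1 < #|S| ->
  (exists i j, [/\ i \in S, j \in S, j != i, forall w, w \in S -> ~~ cyc i w j
                 & col i = col j]) \/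
  (exists2 i, i \in S & forall x, x \in S -> x != i -> col i <> col x).
Proof.
move=> nc S1.
pose P (p : T * T) := [&& p.1 \in S, p.2 \in S, p.2 != p.1 & col p.1 == col p.2].
have [[x0 y0] Pxy|noP] := pickP P; last first.
  have [i iS] : exists i, i \in S by apply/card_gt0P; exact: ltnW.
  right; exists i => // x xS xi ix; have := noP (i, x).
  by rewrite /P iS xS xi ix eqxx.
case: (@arg_minnP _ (x0, y0) P (fun p => #|[set w in S | cyc p.1 w p.2]|) Pxy).
move=> [x y] /and4P[/= xS yS yx /eqP cxy] xymin.
have small u v : u \in S -> v \in S -> cyc x u y -> v != u -> col u = col v ->
    cyc x u v && cyc x v y || (v == x) || (v == y) -> False.
  move=> uS vS cu vu cuv hv.
  have [p [Pp sub [z [zS zp zy]]]] : exists p, [/\ P p,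
     forall w, cyc p.1 w p.2 -> cyc x w y &
     exists z, [/\ z \in S, ~~ cyc p.1 z p.2 & cyc x z y]].
    have [xu uy _] := cyc_neq cu.
    case/orP: hv => [/orP[/andP[h1 h2]|/eqP vx]|/eqP vy].
    - exists (u, v); rewrite /P /= uS vS vu cuv eqxx; split=> //.
        by move=> w; move: h1 h2 cu; cyc_lia.
      by exists u; split=> //; cyc_lia.
    - exists (x, u); rewrite /P /= uS xS eq_sym xu cuv vx eqxx; split=> //.
        by move=> w; move: cu; cyc_lia.
      by exists u; split=> //; cyc_lia.
    - exists (u, y); rewrite /P /= uS yS eq_sym uy cuv vy eqxx; split=> //.
        by move=> w; move: cu; cyc_lia.
      by exists u; split=> //; cyc_lia.
  have := xymin p Pp; rewrite leqNgt => /negP; apply; apply: proper_card.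
  apply/properP; split; last by exists z; rewrite !inE zS ?zy //= (negPf zp).
  by apply/subsetP => w; rewrite !inE => /andP[-> /= /sub].
have [/existsP[w /andP[wS cw]]|no] := boolP [exists w, (w \in S) && cyc x w y]; last first.
  left; exists x, y; split=> // w wS; apply: contra no => cw.
  by apply/existsP; exists w; rewrite wS.
right; exists w => // v vS vw cwv.
have [vx|vx] := eqVneq v x; first by apply: (small w v); rewrite // vx eqxx orbT.
have [vy|vy] := eqVneq v y; first by apply: (small w v); rewrite // vy eqxx orbT.
have [cv|cv] := boolP (cyc x v y).
  have [h|h] := boolP (cyc x w v); first by apply: (small w v); rewrite // h cv.
  apply: (small v w); rewrite // 1?eq_sym // cw andbT; apply/orP; left; apply/orP; left.
  by move: (neq vw) (neq vx) h cv cw; cyc_lia.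
have cv' : cyc y v x by move: (neq vx) (neq vy) (neq yx) cv; cyc_lia.
have cxw := nc x w y v xS wS yS vS cw cv' cxy cwv.
have [xw _ _] := cyc_neq cw.
by apply: (small w x); rewrite ?eqxx ?orbT.
Qed.

(** Only arcs passing over the deleted [i] are new. Such an arc cannot contain [j], now extreme, in
    its interior, so it ends at [j]; the last hypothesis covers this case. *)
Lemma flat_remove_succ S V i j : i \in S -> j \in S -> j != i ->
  (forall w, w \in S -> ~~ cyc i w j) -> flat pos S V same ->
  (forall u, u \in S :\ i -> col u = col j -> cyc u i j ->
     (forall x, x \in S :\ i -> cyc u x j -> x \notin V) ->
     forall w, w \in S :\ i -> cyc u w j -> col u = col w) ->
  flat pos (S :\ i) (j |: V :\ i) same.
Proof.
move=> iS jS ji succ fl H u v uS' vS' uv arc w wS' cw.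
have [ui uS] := setD1P uS'; have [vi vS] := setD1P vS'; have [wi wS] := setD1P wS'.
have notV x : x \in S :\ i -> cyc u x v -> x \notin V.
  move=> xS' cx; have := arc x xS' cx; case/setD1P: xS' => xi _.
  by rewrite !inE xi negb_or => /andP[].
have [cui|cui] := boolP (cyc u i v); last first.
  apply: (fl u v) => // x xS cx; apply: notV => //; rewrite !inE xS andbT.
  by apply: contra cui => /eqP <-.
have jS' : j \in S :\ i by rewrite !inE ji.
have juv : ~~ cyc u j v.
  by apply/negP => cj; have := arc j jS' cj; rewrite !inE eqxx.
have vj : v = j.
  apply/eqP/contraT => vj.
  by move: cui juv (neq vj) (neq ji) (neq vi) (succ v vS) (succ u uS); cyc_lia.
by subst v; exact: H.
Qed.

Lemma flat_remove_pred S V i h : i \in S -> h \in S -> h != i ->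
  (forall w, w \in S -> ~~ cyc h w i) -> flat pos S V same ->
  (forall v, v \in S :\ i -> col h = col v -> cyc h i v ->
     (forall x, x \in S :\ i -> cyc h x v -> x \notin V) ->
     forall w, w \in S :\ i -> cyc h w v -> col h = col w) ->
  flat pos (S :\ i) (h |: V :\ i) same.
Proof.
move=> iS hS hi pred fl H u v uS' vS' uv arc w wS' cw.
have [ui uS] := setD1P uS'; have [vi vS] := setD1P vS'; have [wi wS] := setD1P wS'.
have notV x : x \in S :\ i -> cyc u x v -> x \notin V.
  move=> xS' cx; have := arc x xS' cx; case/setD1P: xS' => xi _.
  by rewrite !inE xi negb_or => /andP[].
have [cui|cui] := boolP (cyc u i v); last first.
  apply: (fl u v) => // x xS cx; apply: notV => //; rewrite !inE xS andbT.
  by apply: contra cui => /eqP <-.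
have hS' : h \in S :\ i by rewrite !inE hi.
have huv : ~~ cyc u h v.
  by apply/negP => cj; have := arc h hS' cj; rewrite !inE eqxx.
have uh : u = h.
  apply/eqP/contraT => uh.
  by move: cui huv (neq uh) (neq hi) (neq ui) (pred v vS) (pred u uS); cyc_lia.
by subst u; exact: (H v vS' uv cui notV w wS' cw).
Qed.

Lemma good_remove S V i : i \notin V -> good pos S V same -> good pos (S :\ i) V same.
Proof.
move=> iV [nc fl]; split; first by apply: noncross_sub nc; exact: subD1set.
move=> u v /setD1P[ui uS] /setD1P[vi vS] uv arc w /setD1P[wi wS] cw.
apply: (fl u v) => // x xS cx; have [->//|xi] := eqVneq x i.
by apply: arc; rewrite // !inE xi.
Qed.

(** Making a neighbour extreme can violate [flat] only on arcs over [i] ending at that neighbour. If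
    one neighbour is already in [V], it blocks the arcs of the other, which is thus safe. If neither
    is, violations on both sides contradict each other. *)
Lemma singleton_choice S V i h j : good pos S V same -> i \in S -> h \in S ->
  j \in S -> h != i -> j != i -> h != j -> V \subset S -> 1 < #|V| ->
  (forall w, w \in S -> ~~ cyc h w i) -> (forall w, w \in S -> ~~ cyc i w j) ->
  (1 < #|j |: V :\ i| /\ flat pos (S :\ i) (j |: V :\ i) same) \/
  (1 < #|h |: V :\ i| /\ flat pos (S :\ i) (h |: V :\ i) same).
Proof.
move=> [nc fl] iS hS jS hi ji hj VS V2 pred succ.
pose avoid p q := [forall x, (x \in S :\ i) && cyc p x q ==> (x \notin V)].
have avoidP p q : (forall x, x \in S :\ i -> cyc p x q -> x \notin V) -> avoid p q.
  by move=> H; apply/forallP => x; apply/implyP => /andP[]; exact: H.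
have avoidE p q : avoid p q -> forall x, x \in S :\ i -> cyc p x q -> x \notin V.
  by move=> /forallP H x xS cx; have := H x; rewrite xS cx.
pose bad p q w := [&& w \in S :\ i, col p == col q, cyc p w q, col w != col p & avoid p q].
pose violj := [exists u, (u \in S :\ i) && [exists w, bad u j w]].
pose violh := [exists v, (v \in S :\ i) && [exists w, bad h v w]].
have okj : ~~ violj -> flat pos (S :\ i) (j |: V :\ i) same.
  move=> nv; apply: flat_remove_succ => // u uS cu _ arc w wS cw; apply/eqP/contraT => ne.
  case/negP: nv; apply/existsP; exists u; rewrite uS; apply/existsP; exists w.
  by rewrite /bad wS cu cw -cu eqxx eq_sym ne avoidP.
have okh : ~~ violh -> flat pos (S :\ i) (h |: V :\ i) same.
  move=> nv; apply: flat_remove_pred => // u uS cu _ arc w wS cw; apply/eqP/contraT => ne.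
  case/negP: nv; apply/existsP; exists u; rewrite uS; apply/existsP; exists w.
  by rewrite /bad wS cu cw -cu eqxx eq_sym ne avoidP.
have only_i w : w \in S -> w != i -> ~~ cyc h w j.
  move=> wS wi; move: (pred w wS) (succ w wS) (pred j jS) (neq wi) (neq hi) (neq ji).
  by cyc_lia.
have card2 x y (W : {set T}) : x != y -> x \in W -> y \in W -> 1 < #|W|.
  move=> xy xW yW; have <- : #|[set x; y]| = 2 by rewrite cards2 xy.
  by apply: subset_leq_card; apply/subsetP => z; rewrite !inE => /orP[] /eqP ->.
have jS' : j \in S :\ i by rewrite !inE ji.
have hS' : h \in S :\ i by rewrite !inE hi.
have [jV|jV] := boolP (j \in V).
  right; split; first by apply: (card2 h j); rewrite // !inE ?eqxx ?ji ?jV ?orbT.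
  apply: okh; apply/negP => /existsP[v /andP[/setD1P[vi vS] /existsP[w]]].
  case/and5P=> /setD1P[wi wS] _ cw _ /avoidE/(_ j jS'); rewrite jV.
  have [vj|vj] := eqVneq v j; first by move: cw; rewrite vj (negPf (only_i w wS wi)).
  have -> : cyc h j v; last by move/(_ isT).
  move: (succ v vS) (succ h hS) (pred j jS) (pred v vS) (neq vi) (neq vj) (neq hi).
  by move: (neq ji) (neq hj); have [_ _ /neq] := cyc_neq cw; cyc_lia.
have [hV|hV] := boolP (h \in V).
  left; split; first by apply: (card2 h j); rewrite // !inE ?eqxx ?hi ?hV ?orbT.
  apply: okj; apply/negP => /existsP[u /andP[/setD1P[ui uS] /existsP[w]]].
  case/and5P=> /setD1P[wi wS] _ cw _ /avoidE/(_ h hS'); rewrite hV.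
  have [uh|uh] := eqVneq u h; first by move: cw; rewrite uh (negPf (only_i w wS wi)).
  have -> : cyc u h j; last by move/(_ isT).
  move: (succ u uS) (succ h hS) (pred j jS) (pred u uS) (neq ui) (neq uh) (neq hi).
  by move: (neq ji) (neq hj); have [_ _ /neq] := cyc_neq cw; cyc_lia.
have cardV k : k \notin V -> 1 < #|k |: V :\ i|.
  move=> kV; rewrite cardsU1 !inE (negPf kV) andbF /=.
  by move: V2; rewrite (cardsD1 i); case: (i \in V) => // V1; rewrite add1n ltnS ltnW.
have [vj|/okj] := boolP violj; last by left; split=> //; exact: cardV.
have [vh|/okh] := boolP violh; last by right; split=> //; exact: cardV.
exfalso.
case/existsP: vj => u /andP[/setD1P[ui uS] /existsP[w]].
case/and5P=> /setD1P[wi wS] /eqP uj cw /eqP wu /avoidE avu.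
case/existsP: vh => v /andP[/setD1P[vi vS] /existsP[z]].
case/and5P=> /setD1P[zi zS] /eqP hv cz _ /avoidE avv.
have uh : u != h by apply: contraTneq cw => ->; exact: only_i.
have vj : v != j by apply: contraTneq cz => ->; exact: only_i.
have [_ _ /neq vh] := cyc_neq cz; have [_ _ /neq ju] := cyc_neq cw.
have cuhj : cyc u h j.
  by move: (succ u uS) (pred u uS) (pred j jS) (neq ui) (neq uh) (neq hi) (neq ji) (neq hj) ju; cyc_lia.
(* The arc from [u] to [h] no longer meets [i]; if its ends had one colour, flatness before the
   deletion would give [w] that colour. *)
have no_uh : col u <> col h.
  move=> cuh; have arc x : x \in S -> cyc u x h -> x \notin V.
    move=> xS cx; apply: avu; last by move: cx cuhj; cyc_lia.
    rewrite !inE xS andbT; apply: contraTneq cx => ->.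
    by move: (pred u uS) (neq uh) (neq ui) (neq hi); cyc_lia.
  have [wh|wh] := eqVneq w h; first by apply: wu; rewrite wh.
  apply: wu; apply/esym; apply: (fl u h) => //.
  by move: (only_i w wS wi) cw cuhj (neq wh); cyc_lia.
(* Otherwise the chords [u j] and [h v] interlace. Hence [v] lies between [u] and [h], and the arcs
   from [u] to [j] and from [h] to [v] together go all the way round. Both avoid [V] except for [i],
   but [V] has another element [t]. *)
have ncv : ~~ cyc j v u.
  by apply/negP => cv; apply: no_uh; exact: (nc u h j v).
have uv : u != v by apply/eqP => uv; apply: no_uh; rewrite hv uv.
have cuv : cyc u v h.
  by move: ncv (only_i v vS vi) cuhj (neq uv) vh (neq vj); cyc_lia.
have /card_gt0P[t] : 0 < #|V :\ i|.
  by move: V2; rewrite (cardsD1 i); case: (i \in V) => // /ltnW.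
rewrite !inE => /andP[ti tV]; have tS := subsetP VS t tV.
have tS' : t \in S :\ i by rewrite !inE ti.
have th : t != h by apply: contraTneq tV => ->.
have tj : t != j by apply: contraTneq tV => ->.
have := avu t tS'; rewrite tV; case E : (cyc u t j); first by move/(_ isT).
have := avv t tS'; rewrite tV; case E' : (cyc h t v); first by move/(_ isT).
by move: E E' (neq th) (neq tj) cuv cuhj; cyc_lia.
Qed.

Lemma good_single S V R : #|S| <= 1 -> good pos S V R.
Proof.
move=> /card_le1_eqP S1; split=> [a b c d aS bS cS dS|u v uS vS uv _ w wS].
  by move=> /cyc_neq[]; rewrite (S1 a b) ?eqxx.
by move=> /cyc_neq[]; rewrite (S1 u w) ?eqxx.
Qed.

Lemma tree_existence n S V : #|S| = n.+1 -> V \subset S ->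
  (0 < n -> 1 < #|V|) -> good pos S V same -> tree_exists pos col n S V.
Proof.
elim: n S V => [|n IH] S V cardS VS V2 gd.
  have /cards1P[x Sx] : #|S| == 1 by rewrite cardS.
  exists (fun _ _ => false), (fun=> x), (fun=> x), pred0; split.
  - by split=> // y z; rewrite Sx !inE => /eqP -> /eqP ->.
  - by move=> A; apply: good_single; rewrite cardS.
  - by move=> y z; rewrite Sx !inE => /eqP -> /eqP ->; split.
have {}V2 := V2 isT; have [nc fl] := gd.
have S1 : 1 < #|S| by rewrite cardS.
have cardD i : i \in S -> #|S :\ i| = n.+1.
  by move=> iS; move: cardS; rewrite (cardsD1 i) iS => -[].
have other x y : exists v, [/\ v \in V, v != x & (x \notin V -> v != y)].
  have [xV|xV] := boolP (x \in V).
    have /card_gt0P[v] : 0 < #|V :\ x| by move: V2; rewrite (cardsD1 x) xV.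
    by rewrite !inE => /andP[vx vV]; exists v; split.
  have /card_gt0P[v] : 0 < #|V :\ y|.
    by move: V2; rewrite (cardsD1 y); case: (y \in V) => // /ltnW.
  rewrite !inE => /andP[vy vV]; exists v; split=> //.
  by apply: contraTneq vV => ->.
have stepF i : i \in S -> i \notin V ->
    (forall x, x \in S -> x != i -> col i <> col x) \/
    (exists k, [/\ k \in S, k != i, col i = col k &
       (forall w, w \in S -> ~~ cyc i w k) \/ (forall w, w \in S -> ~~ cyc k w i)]) ->
    tree_exists pos col n.+1 S V.
  move=> iS iV coli.
  have [h [hS hi pred]] := exists_pred pos iS S1.
  have [j [jS ji succ]] := exists_succ pos iS S1.
  have hj : h != j.
    apply/eqP => hj; have [v [vV vi /(_ iV) vh]] := other i h.
    move: (pred v (subsetP VS v vV)) (succ v (subsetP VS v vV)) (neq vi) (neq vh) (neq hi).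
    by rewrite -hj; cyc_lia.
  apply: (tree_subdivide pos_inj iS iV VS V2 hS jS hi ji hj pred succ); last first.
    apply: IH => //; [exact: cardD| |exact: good_remove].
    by apply/subsetP => v vV; rewrite !inE (subsetP VS) // andbT; apply: contraNneq iV => <-.
  case: coli => [sing|[k [kS ki ik [succk|predk]]]].
  (* If [h] and [j] shared a block, flatness on the arc between them, which holds only the
     nonextreme [i], would put [i] into it. *)
  - left; split=> // chj; apply: (sing h hS hi); rewrite -(fl h j hS jS chj _ i iS) //.
      move=> w wS cw; have [->//|wi] := eqVneq w i.
      by move: (pred w wS) (succ w wS) (pred j jS) (neq wi) (neq hi) (neq ji) cw; cyc_lia.
    by move: (pred j jS) (neq hi) (neq ji) (neq hj); cyc_lia.
  - right; left; rewrite ik; congr col; apply/eqP/contraT => kj.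
    by move: (succk j jS) (succ k kS) (neq ki) (neq ji) (neq kj); cyc_lia.
  - right; right; rewrite ik; congr col; apply/eqP/contraT => kh.
    by move: (predk h hS) (pred k kS) (neq ki) (neq hi) (neq kh); cyc_lia.
have VD i k : k \in S -> k != i -> k |: V :\ i \subset S :\ i.
  move=> kS ki; apply/subsetP => v; rewrite !inE => /orP[/eqP ->|/andP[-> /(subsetP VS)]] //.
  by rewrite ki.
have stepV i k : i \in S -> i \in V -> k \in S -> k != i -> adjacent pos S i k ->
    (col i = col k \/ forall x, x \in S -> x != i -> col i <> col x) ->
    (0 < n -> 1 < #|k |: V :\ i|) -> (0 < n -> flat pos (S :\ i) (k |: V :\ i) same) ->
    tree_exists pos col n.+1 S V.
  move=> iS iV kS ki adj coli V2' fl'.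
  apply: (tree_attach pos_inj iS iV kS ki cardS adj V2' VS coli).
  apply: IH => //; [exact: cardD | exact: VD |].
  have [n0|n0] := posnP n; first by apply: good_single; rewrite cardD // n0.
  by split; [apply: noncross_sub nc; exact: subD1set | exact: fl'].
have [[i [j [iS jS ji succ ij]]]|[i iS sing]] := adjacent_or_singleton nc S1; last first.
  have [iV|iV] := boolP (i \in V); last by apply: (stepF i) => //; left.
  have [h [hS hi pred]] := exists_pred pos iS S1.
  have [j [jS ji succ]] := exists_succ pos iS S1.
  have adj_j := succ_adjacent pos_inj iS jS ji succ.
  have adj_h : adjacent pos S i h.
    by apply: adjacent_sym; apply: succ_adjacent; rewrite // eq_sym.
  have [n0|n0] := posnP n.
    by apply: (stepV i j) => //; [right | rewrite n0 | rewrite n0].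
  have hj : h != j.
    apply: contraTneq S1 => hj; rewrite -leqNgt.
    have : 0 < #|S :\ i :\ h|.
      by have := cardD i iS; rewrite (cardsD1 h) !inE hi hS /= add1n => -[->].
    case/card_gt0P => v; rewrite !inE => /and3P[vh vi vS].
    by move: (pred v vS) (succ v vS) (neq vi) (neq vh) (neq hi); rewrite -hj; cyc_lia.
  have [[V2' fl']|[V2' fl']] := singleton_choice gd iS hS jS hi ji hj VS V2 pred succ.
    by apply: (stepV i j) => //; right.
  by apply: (stepV i h) => //; right.
have [iV|iV] := boolP (i \in V); last first.
  by apply: (stepF i) => //; right; exists j; split=> //; left.
have [jV|jV] := boolP (j \in V); last first.
  by apply: (stepF j) => //; right; exists i; rewrite eq_sym; split=> //; right.
(* Both [i] and [j] are extreme. With a third extreme point, [i] can go. With no other, deleting [i]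
   would break the invariant on [V]; but then the arc from [j] to [i] has no extreme point, flatness
   puts all of it into the block of [j], and its first point [k] can be removed as a nonextreme
   point. *)
have [small|big] := leqP #|V| 2; last first.
  apply: (stepV i j) => //.
  - exact: succ_adjacent.
  - by left.
  - move=> _; rewrite cardsU1 !inE jV ji /= add0n.
    by move: big; rewrite (cardsD1 i) iV add1n.
  move=> _; apply: flat_remove_succ => // u /setD1P[ui uS] uj cu arc w /setD1P[wi wS] cw.
  apply: (fl u i) => //; first by rewrite uj.
    move=> x xS cx; have [_ xi _] := cyc_neq cx.
    by apply: arc; [rewrite !inE xi | move: cx cu; cyc_lia].
  by move: cw cu (succ w wS) (neq wi); cyc_lia.
have VE : V = [set i; j].
  apply/esym/eqP; rewrite eqEcard cards2 eq_sym ji small andbT.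
  by apply/subsetP => v; rewrite !inE => /orP[] /eqP ->.
have [n0|n0] := posnP n.
  by apply: (stepV i j); rewrite ?n0 //; [exact: succ_adjacent | left].
have [k [kS kj succk]] := exists_succ pos jS S1.
have ki : k != i.
  apply/eqP => ki; have : 0 < #|S :\ i :\ j|.
    by have := cardD i iS; rewrite (cardsD1 j) !inE ji jS /= add1n => -[->].
  case/card_gt0P => v; rewrite !inE => /and3P[vj vi vS].
  by move: (succk v vS) (succ v vS) (neq vi) (neq vj) (neq ji); rewrite ki; cyc_lia.
apply: (stepF k) => //; first by rewrite VE !inE negb_or ki.
right; exists j; split; rewrite // 1?eq_sym //; last by right.
apply/esym; apply: (fl j i) => //.
  move=> w wS cw; rewrite VE !inE negb_or.
  by have [/negPf jw /negPf wi _] := cyc_neq cw; rewrite wi eq_sym jw.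
by move: (succk i iS) (neq ki) (neq kj) (neq ji); cyc_lia.
Qed.

End TreeInduction.

(** * Plane geometry *)

Import Order.TTheory GRing.Theory Num.Theory.
Local Open Scope ring_scope.

Section PlaneGeometry.
Context {R : realFieldType}.
Implicit Types (a b c d p q w x y z : 'rV[R]_2) (t : R).

Definition abscissa p : R := p ord0 ord0.
Definition ordinate p : R := p ord0 ord_max.
Local Notation X := abscissa.
Local Notation Y := ordinate.

(** Twice the signed area of the triangle, positive when [a], [b], [c] turn counterclockwise. *)
Definition area a b c : R := (X b - X a) * (Y c - Y a) - (Y b - Y a) * (X c - X a).

(** A total order on the plane whose restriction to any line, vertical ones included, is an order
    along that line; betweenness of collinear points reduces to it. *)
Definition lexlt a b : bool := (X a < X b) || (X a == X b) && (Y a < Y b).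

Definition inside a c b : Prop :=
  a != b /\ exists2 t, 0 < t < 1 & c = (1 - t) *: a + t *: b.

Lemma plane_eqP a b : X a = X b -> Y a = Y b -> a = b.
Proof.
move=> eX eY; apply/rowP => i; have [->|->] : i = ord0 \/ i = ord_max.
  by case: i => [[|[|//]] h]; [left | right]; apply: val_inj.
- exact: eX.
- exact: eY.
Qed.

Lemma coord_comb s t a b : X (s *: a + t *: b) = s * X a + t * X b
  /\ Y (s *: a + t *: b) = s * Y a + t * Y b.
Proof. by rewrite /X /Y !mxE. Qed.

Lemma area_rot a b c : area a b c = area b c a.
Proof. by rewrite /area; ring. Qed.

Lemma area_swap a b c : area a c b = - area a b c.
Proof. by rewrite /area; ring. Qed.

Lemma area_comb a b p q t :
  area a b ((1 - t) *: p + t *: q) = (1 - t) * area a b p + t * area a b q.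
Proof. by rewrite /area !(coord_comb _ _ _ _).1 !(coord_comb _ _ _ _).2; ring. Qed.

Lemma area_aab a b : area a b a = 0 /\ area a b b = 0.
Proof. by split; rewrite /area; ring. Qed.

Lemma lexlt_irr a : lexlt a a = false.
Proof. by rewrite /lexlt !ltxx andbF. Qed.

Lemma lexlt_trans b a c : lexlt a b -> lexlt b c -> lexlt a c.
Proof.
rewrite /lexlt => /orP[h|/andP[/eqP e h]] /orP[h'|/andP[/eqP e' h']].
- by rewrite (lt_trans h h').
- by rewrite -e' h.
- by rewrite e h'.
- by rewrite e e' eqxx (lt_trans h h') orbT.
Qed.

Lemma lexlt_total a b : a != b -> lexlt a b || lexlt b a.
Proof.
move=> ab; rewrite /lexlt; case: ltgtP => //= eX; case: ltgtP => //= eY.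
by rewrite (plane_eqP eX eY) eqxx in ab.
Qed.

Lemma lexlt_asym a b : lexlt a b -> lexlt b a -> False.
Proof. by move=> ab /(lexlt_trans ab); rewrite lexlt_irr. Qed.

Lemma inside_sym a c b : inside a c b -> inside b c a.
Proof.
move=> [ab [t t01 ->]]; split; first by rewrite eq_sym.
by exists (1 - t); [lra | rewrite addrC subKr].
Qed.

Lemma inside_neq a c b : inside a c b -> c != a /\ c != b.
Proof.
move=> [ab [t t01 ->]].
have key s : s != 0 -> (s *: (b - a) == 0) = false.
  by move=> s0; rewrite scaler_eq0 (negPf s0) subr_eq0 eq_sym (negPf ab).
split; rewrite -subr_eq0.
  have -> : (1 - t) *: a + t *: b - a = t *: (b - a).
    by rewrite scalerBl scale1r scalerBr addrAC [a - _]addrC addrK addrC.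
  by rewrite key //; lra.
have -> : (1 - t) *: a + t *: b - b = (- (1 - t)) *: (b - a).
  by rewrite scaleNr scalerBr opprB scalerBl scale1r [(1-t) *: b]scalerBl scale1r opprB addrA addrAC.
by rewrite key //; lra.
Qed.

Lemma lexlt_comb a b t : lexlt a b -> 0 < t < 1 ->
  lexlt a ((1 - t) *: a + t *: b) /\ lexlt ((1 - t) *: a + t *: b) b.
Proof.
rewrite /lexlt !(coord_comb _ _ _ _).1 !(coord_comb _ _ _ _).2 => ab t01.
case/orP: ab => [h|/andP[/eqP e h]].
  by split; apply/orP; left; nra.
by split; apply/orP; right; apply/andP; split; try (apply/eqP; rewrite e; ring); nra.
Qed.

Lemma inside_lex a c b : inside a c b ->
  area a b c = 0 /\ (lexlt a c && lexlt c b || lexlt b c && lexlt c a).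
Proof.
move=> [ab [t t01 ->]]; split.
  by rewrite area_comb (area_aab a b).1 (area_aab a b).2 !mulr0 addr0.
case/orP: (lexlt_total ab) => h.
  by have [-> ->] := lexlt_comb h t01.
have s01 : 0 < 1 - t < 1 by lra.
have := lexlt_comb h s01; rewrite subKr addrC => -[-> ->].
by rewrite orbT.
Qed.

Lemma lex_inside a c b : area a b c = 0 -> lexlt a c -> lexlt c b -> inside a c b.
Proof.
move=> D0 ac cb; have ab := lexlt_trans ac cb; split.
  by apply: contraTneq ab => ->; rewrite lexlt_irr.
move: D0 ac cb ab; rewrite /lexlt /area => D0.
have [h|h|h] := ltgtP (X a) (X b) => //= ac cb.
  have {}ac : X a < X c by case/orP: ac => [//|/andP[/eqP e l]]; rewrite e in h D0 *; nra.
  have {}cb : X c < X b by case/orP: cb => [//|/andP[/eqP e l]]; rewrite e in ac D0 *; nra.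
  move=> _; have nz : X b - X a != 0 by lra.
  exists ((X c - X a) / (X b - X a)).
    by rewrite divr_gt0 ?ltr_pdivrMr /=; lra.
  apply: plane_eqP; rewrite ?(coord_comb _ _ _ _).1 ?(coord_comb _ _ _ _).2.
    by field.
  apply: (mulfI nz); transitivity (Y a * (X b - X a) + (X c - X a) * (Y b - Y a)).
    by lra.
  by field.
move=> l; have eX : X c = X a by case/orP: ac => [u|/andP[/eqP ->//]]; case/orP: cb => [v|/andP[/eqP ->//]]; lra.
rewrite eX ltxx eqxx /= in ac; rewrite eX h ltxx eqxx /= in cb.
have nz : Y b - Y a != 0 by lra.
exists ((Y c - Y a) / (Y b - Y a)).
  by rewrite divr_gt0 ?ltr_pdivrMr /=; lra.
apply: plane_eqP; rewrite ?(coord_comb _ _ _ _).1 ?(coord_comb _ _ _ _).2.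
  by rewrite eX h; ring.
by field.
Qed.

(** The witness is the ratio in which [w] divides the segment, read off from the areas of the two
    triangles with apex [z]. *)
Lemma area_inside a b w z : area a b w = 0 -> 0 < area a b z -> 0 <= area a w z ->
  0 <= area w b z -> w != a -> w != b -> inside a w b.
Proof.
move=> D0 S0 A0 B0 wa wb; set S := area a b z in S0.
have Sn : S != 0 by rewrite gt_eqF.
have ABS : area a w z + area w b z = S.
  by rewrite -[LHS]addr0 -D0 /S /area; ring.
have eX : (X w - X a) * S = area a w z * (X b - X a).
  apply/eqP; rewrite -subr_eq0; apply/eqP; transitivity ((X z - X a) * area a b w).
    by rewrite /S /area; ring.
  by rewrite D0 mulr0.
have eY : (Y w - Y a) * S = area a w z * (Y b - Y a).
  apply/eqP; rewrite -subr_eq0; apply/eqP; transitivity ((Y z - Y a) * area a b w).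
    by rewrite /S /area; ring.
  by rewrite D0 mulr0.
have wE : w = (1 - area a w z / S) *: a + (area a w z / S) *: b.
  apply: plane_eqP; rewrite ?(coord_comb _ _ _ _).1 ?(coord_comb _ _ _ _).2.
    apply: (mulIf Sn); transitivity (X a * S + area a w z * (X b - X a)).
      by rewrite -eX; ring.
    by move: (area a w z) => A; field.
  apply: (mulIf Sn); transitivity (Y a * S + area a w z * (Y b - Y a)).
    by rewrite -eY; ring.
  by move: (area a w z) => A; field.
have A1 : area a w z != 0.
  by apply: contra wa => /eqP A1; rewrite wE A1 mul0r subr0 scale1r scale0r addr0.
have B1 : area w b z != 0.
  apply: contra wb => /eqP B1; rewrite B1 addr0 in ABS.
  by rewrite wE ABS divff // subrr scale1r scale0r add0r.
split.
  apply: contra_neq Sn => ab; rewrite /S ab /area; ring.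
exists (area a w z / S) => //.
have A2 : 0 < area a w z by rewrite lt_neqAle eq_sym A1.
have B2 : 0 < area w b z by rewrite lt_neqAle eq_sym B1.
by rewrite divr_gt0 //= ltr_pdivrMr // mul1r -ABS ltrDl.
Qed.

(** Each coordinate of [b - a], multiplied by [area x y z], is a combination of the three vanishing
    areas, and one of these coordinates is nonzero. *)
Lemma area_collinear a b x y z : a != b -> area a b x = 0 -> area a b y = 0 ->
  area a b z = 0 -> area x y z = 0.
Proof.
move=> ab hx hy hz.
have eX : (X b - X a) * area x y z = 0.
  transitivity ((X y - X x) * (area a b z - area a b x)
                - (X z - X x) * (area a b y - area a b x)).
    by rewrite /area; ring.
  by rewrite hx hy hz; ring.
have eY : (Y b - Y a) * area x y z = 0.
  transitivity ((Y y - Y x) * (area a b z - area a b x)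
                - (Y z - Y x) * (area a b y - area a b x)).
    by rewrite /area; ring.
  by rewrite hx hy hz; ring.
apply/eqP/contraT => nz; case/negP: ab; apply/eqP.
move/eqP: eX; rewrite mulf_eq0 (negPf nz) orbF subr_eq0 => /eqP eX.
move/eqP: eY; rewrite mulf_eq0 (negPf nz) orbF subr_eq0 => /eqP eY.
exact: plane_eqP.
Qed.

(** The line [b d] divides [a c] in the ratio of the areas of [a b d] and [b c d], and likewise for
    the other diagonal; both pairs of areas sum to [S]. *)
Lemma diagonals_meet a b c d : 0 < area a b d + area b c d ->
  let S := area a b d + area b c d in
  (area b c d / S) *: a + (area a b d / S) *: c =
  (area a c d / S) *: b + (area a b c / S) *: d.
Proof.
move=> S0 S; have Sn : S != 0 by rewrite gt_eqF.
have k A t : A / S * t * S = A * t by rewrite mulrAC divfK.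
by apply: plane_eqP; rewrite ?(coord_comb _ _ _ _).1 ?(coord_comb _ _ _ _).2;
  apply: (mulIf Sn); rewrite !mulrDl !k /area; ring.
Qed.

(* Directions in the half-plane of lexicographically positive vectors are
   linearly ordered by the sign of the determinant. *)
Lemma turn_trans p x y z : lexlt p x -> lexlt p y -> lexlt p z ->
  0 <= area p x y -> 0 <= area p y z ->
  0 <= area p x z /\ (0 < area p x y \/ 0 < area p y z -> 0 < area p x z).
Proof.
rewrite /lexlt /area.
set x1 := X x - X p; set x2 := Y x - Y p; set y1 := X y - X p; set y2 := Y y - Y p.
set z1 := X z - X p; set z2 := Y z - Y p => hx hy hz.
have {}hx : 0 < x1 \/ x1 = 0 /\ 0 < x2.
  by case/orP: hx => [|/andP[/eqP]] h; [left | move=> l; right]; rewrite /x1 /x2; lra.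
have {}hy : 0 < y1 \/ y1 = 0 /\ 0 < y2.
  by case/orP: hy => [|/andP[/eqP]] h; [left | move=> l; right]; rewrite /y1 /y2; lra.
have {}hz : 0 < z1 \/ z1 = 0 /\ 0 < z2.
  by case/orP: hz => [|/andP[/eqP]] h; [left | move=> l; right]; rewrite /z1 /z2; lra.
move: hx hy hz; move: x1 x2 y1 y2 z1 z2 => x1 x2 y1 y2 z1 z2.
move=> hx [hy|[-> hy]] hz xy yz; last first.
  have z10 : z1 = 0 by case: hz => [h|[]//]; nra.
  have z20 : 0 < z2 by case: hz => [h|[]//]; lra.
  have x10 : 0 <= x1 by case: hx => [|[]]; lra.
  rewrite z10 mulr0 subr0; split; first by apply: mulr_ge0 => //; lra.
  by move=> h; apply: mulr_gt0 => //; case: h => h; nra.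
(* The three-term relation among 2 by 2 determinants: on its right side every factor is
   nonnegative. *)
have e : y1 * (x1 * z2 - x2 * z1) = x1 * (y1 * z2 - y2 * z1) + z1 * (x1 * y2 - x2 * y1).
  by ring.
have x10 : 0 <= x1 by case: hx => [|[]]; lra.
have z10 : 0 <= z1 by case: hz => [|[]]; lra.
split; first by rewrite -(pmulr_rge0 _ hy) e addr_ge0 ?mulr_ge0.
have x1p : 0 < x1 by case: hx => [//|[e0 h]]; rewrite e0 in xy *; nra.
move=> h; rewrite -(pmulr_rgt0 _ hy) e.
have [yz0|yz0] := ltrP 0 (y1 * z2 - y2 * z1).
  by apply: ltr_wpDr; [exact: mulr_ge0 | exact: mulr_gt0].
have xy0 : 0 < x1 * y2 - x2 * y1 by case: h => // h; lra.
have [z0|z0] := ltrP 0 z1.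
  by apply: ltr_wpDl; [exact: mulr_ge0 | exact: mulr_gt0].
have z00 : z1 = 0 by lra.
by case: hz => [|[_ z2p]]; [lra | rewrite z00 in yz yz0; nra].
Qed.

End PlaneGeometry.

(** * The cyclic order of a planar configuration *)

Section Configuration.
Context {R : realFieldType}.

Lemma insideP (a c b : 'rV[R]_2) :
  reflect (inside a c b) ((area a b c == 0)
    && (lexlt a c && lexlt c b || lexlt b c && lexlt c a)).
Proof.
apply: (iffP idP) => [/andP[/eqP D0 /orP[/andP[ac cb]|/andP[bc ca]]]|].
- exact: lex_inside.
- by apply: inside_sym; apply: lex_inside; rewrite // area_rot area_swap D0 oppr0.
- by move=> /inside_lex[-> ->]; rewrite eqxx.
Qed.

Context {T : finType} (pt : T -> 'rV[R]_2).
Hypothesis pt_inj : injective pt.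
Implicit Types (a b c d p q u v w x y z : T).

Local Notation D x y z := (area (pt x) (pt y) (pt z)).
Local Notation lex x y := (lexlt (pt x) (pt y)).
Local Notation inside x y z := (inside (pt x) (pt y) (pt z)).

(* The two ways in which a point of a finite planar set can be interior to its
   convex hull: strictly inside a triangle, or on a segment with points
   strictly on both sides. *)
Hypothesis no_triangle :
  forall a b c p, 0 < D a b p -> 0 < D b c p -> 0 < D c a p -> False.
Hypothesis no_crossing :
  forall a b c d p, inside a p b -> 0 < D a b c -> D a b d < 0 -> False.

Lemma lex_total x y : x != y -> lex x y || lex y x.
Proof. by move=> xy; apply: lexlt_total; rewrite (inj_eq pt_inj). Qed.

Lemma exists_minimum (P : pred T) (r : rel T) x0 : P x0 -> irreflexive r ->
  transitive r -> (forall x y, x != y -> r x y || r y x) ->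
  exists m, P m /\ forall x, P x -> x != m -> r m x.
Proof.
move=> Px0 irr tr tot.
case: (@arg_minnP _ x0 P (fun x => #|[set y | P y && r y x]|) Px0) => m Pm mmin.
exists m; split=> // x Px xm; case/orP: (tot x m xm) => // rxm.
have := mmin x Px; rewrite leqNgt => /negP[]; apply: proper_card; apply/properP; split.
  by apply/subsetP => y; rewrite !inE => /andP[-> /= ryx]; exact: tr rxm.
by exists x; rewrite !inE Px ?rxm ?irr.
Qed.

Section Order.
Context (p0 : T).
Hypothesis p0_min : forall x, x != p0 -> lex p0 x.

(* Counterclockwise order about the lexicographically least point [p0]. A ray
   from [p0] with several points supports the hull: points on it are listed
   outwards on the first ray and inwards on the last one. *)
Definition before x y : bool :=
  (y != p0) && [|| x == p0, 0 < D p0 x y |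
    (D p0 x y == 0) && (if [exists z, D p0 x z < 0] then lex y x else lex x y)].

Lemma before_irr : irreflexive before.
Proof.
move=> x; rewrite /before; have [//|/negPf xp] := eqVneq x p0.
by rewrite (area_aab (pt p0) (pt x)).2 ltxx lexlt_irr if_same andbF.
Qed.

Lemma before_p0 x : x != p0 -> before p0 x.
Proof. by move=> xp; rewrite /before xp eqxx. Qed.

Lemma before_area x y : x != p0 -> before x y -> 0 <= D p0 x y.
Proof.
by move=> /negPf xp; rewrite /before xp /= => /andP[_ /orP[/ltW//|/andP[/eqP -> _]]].
Qed.

(** The branch taken in [before] depends only on the ray, so all points of a ray are listed in the
    same direction. *)
Lemma same_ray x y : x != p0 -> y != p0 -> D p0 x y = 0 ->
  [exists z, D p0 x z < 0] -> [exists z, D p0 y z < 0].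
Proof.
move=> xp yp D0 /existsP[z]; have [->|zp] := eqVneq z p0.
  by rewrite (area_aab _ _).1 ltxx.
move=> xz; apply/existsP; exists z; rewrite area_swap oppr_lt0.
have zx : 0 < D p0 z x by rewrite area_swap oppr_gt0.
have xy : 0 <= D p0 x y by rewrite D0.
apply: (turn_trans (p0_min zp) (p0_min xp) (p0_min yp) (ltW zx) xy).2.
by left.
Qed.

Lemma same_rayE x y : x != p0 -> y != p0 -> D p0 x y = 0 ->
  [exists z, D p0 x z < 0] = [exists z, D p0 y z < 0].
Proof.
move=> xp yp D0; apply/idP/idP; first exact: same_ray.
by apply: same_ray; rewrite // area_swap D0 oppr0.
Qed.

Lemma before_trans : transitive before.
Proof.
move=> y x z xy yz; have yp : y != p0 by case/andP: xy.
have zp : z != p0 by case/andP: yz.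
have [->|xp] := eqVneq x p0; first exact: before_p0.
have [ge0 gt0] := turn_trans (p0_min xp) (p0_min yp) (p0_min zp)
  (before_area xp xy) (before_area yp yz).
rewrite /before zp (negPf xp) /=.
move: xy yz; rewrite /before yp zp (negPf xp) (negPf yp) /=.
case/orP=> [h|/andP[/eqP xy xyl]]; first by rewrite gt0 //; left.
case/orP=> [h|/andP[/eqP yz yzl]]; first by rewrite gt0 //; right.
have xz : D p0 x z = 0.
  apply/eqP; rewrite eq_le ge0 andbT -oppr_ge0 -area_swap.
  apply: (turn_trans (p0_min zp) (p0_min yp) (p0_min xp) _ _).1.
    by rewrite area_swap yz oppr0.
  by rewrite area_swap xy oppr0.
rewrite xz eqxx /= -(same_rayE xp yp xy) in yzl *.
by case: ifP xyl yzl => _ h1 h2; rewrite ?orbT ?(lexlt_trans h2 h1) ?(lexlt_trans h1 h2) ?orbT.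
Qed.

Lemma before_total x y : x != y -> before x y || before y x.
Proof.
move=> xy; have [xp|xp] := eqVneq x p0.
  by rewrite xp before_p0 // -xp eq_sym.
have [yp|yp] := eqVneq y p0; first by rewrite orbC yp before_p0 // -yp.
rewrite /before xp yp (negPf xp) (negPf yp) /= area_swap oppr_gt0 oppr_eq0.
case: ltgtP => //= D0; rewrite (same_rayE yp xp D0).
by have := lex_total xy; rewrite orbC; case: ifP; rewrite // orbC.
Qed.

Definition rank x : nat := #|[set y | before y x]|.

Lemma before_rank x y : before x y -> (rank x < rank y)%N.
Proof.
move=> xy; apply: proper_card; apply/properP; split.
  by apply/subsetP => z; rewrite !inE => zx; exact: before_trans zx xy.
by exists x; rewrite !inE ?before_irr.
Qed.

Lemma rank_before x y : (rank x < rank y)%N -> before x y.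
Proof.
move=> xy; have [e|ne] := eqVneq x y; first by rewrite e ltnn in xy.
by case/orP: (before_total ne) => // /before_rank; rewrite ltnNge ltnW.
Qed.

Lemma rank_inj : injective rank.
Proof.
move=> x y exy; apply/eqP/contraT => /before_total/orP[] /before_rank;
  by rewrite exy ltnn.
Qed.

(** Here the hypotheses on interior points enter. If both turns about [p0] are strict, a clockwise
    [x y z] puts [y] strictly inside the triangle [p0 x z]. If only [y] and [z] share a ray, it is
    not the first one, so [z] lies between [p0] and [y]. If only [x] and [y] do, then either [x]
    lies between [p0] and [y], or points on both sides of the ray contradict [no_crossing]. *)
Lemma before_convex x y z : before x y -> before y z -> 0 <= D x y z.
Proof.
move=> xy yz; have yp : y != p0 by case/andP: xy.
have zp : z != p0 by case/andP: yz.
have [->|xp] := eqVneq x p0; first exact: before_area.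
have xyA := before_area xp xy; have yzA := before_area yp yz.
rewrite leNgt; apply/negP => neg.
have [xy0|xy0] := ltrP 0 (D p0 x y); have [yz0|yz0] := ltrP 0 (D p0 y z).
- apply: (@no_triangle p0 x z y) => //; first by rewrite area_swap oppr_gt0.
  by rewrite area_rot.
- have {}yz0 : D p0 y z = 0 by apply/eqP; rewrite eq_le yz0 yzA.
  move: yz; rewrite /before zp (negPf yp) yz0 ltxx eqxx /=.
  have -> : [exists z, D p0 y z < 0].
    by apply/existsP; exists x; rewrite area_swap oppr_lt0.
  move=> zy; have [_ [t t01 ez]] : inside p0 z y.
    by apply: lex_inside => //; exact: p0_min.
  move: neg; rewrite ez area_comb (area_aab _ _).2 mulr0 addr0 -area_rot.
  have : 0 < (1 - t) * D p0 x y by apply: mulr_gt0 => //; lra.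
  by lra.
- have {}xy0 : D p0 x y = 0 by apply/eqP; rewrite eq_le xy0 xyA.
  have xz0 : 0 < D p0 x z.
    by apply: (turn_trans (p0_min xp) (p0_min yp) (p0_min zp) xyA yzA).2; right.
  move: xy; rewrite /before yp (negPf xp) xy0 ltxx eqxx /=.
  have yx0 : D p0 y x = 0 by rewrite area_swap xy0 oppr0.
  case: ifP => [/existsP[t xt] yx|_ xy].
    have ins : inside p0 y x by apply: lex_inside => //; exact: p0_min.
    exact: no_crossing ins xz0 xt.
  have [_ [t t01 ex]] : inside p0 x y by apply: lex_inside => //; exact: p0_min.
  move: neg; rewrite area_rot ex area_comb (area_aab _ _).1 mulr0 addr0.
  rewrite -(area_rot (pt p0) (pt y) (pt z)).
  have : 0 < (1 - t) * D p0 y z by apply: mulr_gt0 => //; lra.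
  by lra.
- have xy1 : D p0 y x = 0 by rewrite area_swap; lra.
  have yz1 : D p0 y z = 0 by lra.
  move: neg; rewrite (area_collinear _ xy1 (area_aab _ _).2 yz1) ?ltxx //.
  by rewrite (inj_eq pt_inj) eq_sym.
Qed.

Local Notation cyc := (cyc_order rank).
Local Notation neq := (pos_neq rank_inj).

Lemma cyc_convex x y z : cyc x y z -> 0 <= D x y z.
Proof.
rewrite /cyc_order => /or3P[] /andP[/rank_before h1 /rank_before h2].
- exact: before_convex.
- by rewrite area_rot; exact: before_convex.
- by rewrite -area_rot; exact: before_convex.
Qed.

(** All points other than [p0] are on a single first ray, which is listed outwards. *)
Lemma collinear_before : (forall x y z, D x y z = 0) ->
  forall x y, (rank x < rank y)%N = lex x y.
Proof.
move=> col x y; have no z : [exists t, D p0 z t < 0] = false.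
  by apply/existsP => -[t]; rewrite col ltxx.
have bl u v : before u v -> lex u v.
  rewrite /before col eqxx ltxx no /= => /andP[vp /orP[/eqP ->|//]].
  exact: p0_min.
apply/idP/idP => [/rank_before/bl//|lxy].
have xy : x != y by apply: contraTneq lxy => ->; rewrite lexlt_irr.
apply: before_rank; case/orP: (before_total xy) => // /bl lyx.
by case: (lexlt_asym lxy lyx).
Qed.

Lemma exists_lexmin x0 : exists m, forall x, x != m -> lex m x.
Proof.
have [|||m [_ h]] := @exists_minimum predT (fun x y => lex x y) x0 isT.
- by move=> x; exact: lexlt_irr.
- by move=> y x z; exact: lexlt_trans.
- exact: lex_total.
by exists m => x; exact: h.
Qed.

Lemma exists_lexmax x0 : exists m, forall x, x != m -> lex x m.
Proof.
have [|||m [_ h]] := @exists_minimum predT (fun x y => lex y x) x0 isT.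
- by move=> x; exact: lexlt_irr.
- by move=> y x z h1 h2; exact: lexlt_trans h2 h1.
- by move=> x y; rewrite orbC; exact: lex_total.
by exists m => x; exact: h.
Qed.

(** A point [z] off the line [a b] is not on the arc, so it comes after [b]; [cyc_convex] then gives
    the signs required by [area_inside]. *)
Lemma arc_collinear_inside a b w : (forall x, cyc a x b -> D a b x = 0) ->
  cyc a w b -> (forall z, D a b z = 0) \/ inside a w b.
Proof.
move=> arc cw.
have [/existsP[z Dz]|no] := boolP [exists z, D a b z != 0]; last first.
  left=> z; apply/eqP; apply: contraNT no => Dz; apply/existsP; by exists z.
right; have [aw wb ba] := cyc_neq cw.
have za : z != a by apply: contraNneq Dz => ->; rewrite (area_aab _ _).1.
have zb : z != b by apply: contraNneq Dz => ->; rewrite (area_aab _ _).2.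
have nz : ~~ cyc a z b by apply: contra Dz => /arc ->.
have abz : cyc a b z by move: nz (neq za) (neq zb) (neq ba); cyc_lia.
apply: (@area_inside _ _ _ _ (pt z)).
- exact: arc.
- by rewrite lt_neqAle eq_sym Dz cyc_convex.
- by apply: cyc_convex; move: abz cw; cyc_lia.
- by apply: cyc_convex; move: abz cw; cyc_lia.
- by rewrite (inj_eq pt_inj) eq_sym.
- by rewrite (inj_eq pt_inj).
Qed.

Lemma all_collinear a b : a != b -> (forall z, D a b z = 0) -> forall x y z, D x y z = 0.
Proof.
by move=> ab h x y z; apply: (area_collinear _ (h x) (h y) (h z)); rewrite (inj_eq pt_inj).
Qed.

(** A point of the arc is on one side of the line [a b] by convexity with [a] and [b], and on the
    other by convexity with [c] and one end. So the arc is collinear. If everything is collinear,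
    the cyclic order is that of [lexlt]. *)
Lemma inside_arc a c b w : inside a c b -> cyc a c b -> cyc a w b -> inside a w b.
Proof.
move=> ins cc cw; have [ab _] := ins; rewrite (inj_eq pt_inj) in ab.
have arc x : cyc a x b -> D a b x = 0.
  move=> cx; have [->|xc] := eqVneq x c; first exact: (inside_lex ins).1.
  have [_ [t t01 ec]] := ins; have t0 : 0 < t by lra.
  have t1 : 0 < 1 - t by lra.
  have le0 : 0 <= D a x b by exact: cyc_convex.
  have ge0 : 0 <= - D a x b.
    have [h|h] := boolP (cyc a x c).
      have : 0 <= D x c b by apply: cyc_convex; move: h cc; cyc_lia.
      rewrite -area_rot ec area_comb (area_aab _ _).1 mulr0 addr0.
      by rewrite (pmulr_rge0 _ t1) -area_swap (area_rot (pt a)).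
    have : 0 <= D a c x by apply: cyc_convex; move: h cx cc (neq xc); cyc_lia.
    rewrite -area_rot ec area_comb (area_aab _ _).2 mulr0 add0r.
    by rewrite (pmulr_rge0 _ t0) -area_swap (area_rot (pt x)).
  by rewrite area_swap; lra.
have [col|//] := arc_collinear_inside arc cw.
have {}col := all_collinear ab col.
have lexE := collinear_before col.
apply/insideP; rewrite col eqxx /= -!lexE.
have [_] := inside_lex ins; rewrite -!lexE.
by move: cw cc; cyc_lia.
Qed.

Definition extreme : {set T} :=
  [set w | ~~ [exists a, exists b, (D a b w == 0) &&
                 (lex a w && lex w b || lex b w && lex w a)]].

Lemma extremePn w : reflect (exists a b, inside a w b) (w \notin extreme).
Proof.
rewrite inE negbK; apply: (iffP existsP) => -[a h]; exists a.
  by case/existsP: h => b /insideP h; exists b.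
by case: h => b /insideP h; apply/existsP; exists b.
Qed.

Lemma lexmin_extreme m : (forall x, x != m -> lex m x) -> m \in extreme.
Proof.
move=> mmin; apply/negPn/negP => /extremePn[a [b ins]].
have [/negPf ma /negPf mb] := inside_neq ins; rewrite !(inj_eq pt_inj) in ma mb.
have := (inside_lex ins).2.
have la : lex m a by apply: mmin; rewrite eq_sym ma.
have lb : lex m b by apply: mmin; rewrite eq_sym mb.
by case/orP => /andP[h1 h2]; [apply: (lexlt_asym la h1) | apply: (lexlt_asym lb h1)].
Qed.

Lemma lexmax_extreme m : (forall x, x != m -> lex x m) -> m \in extreme.
Proof.
move=> mmax; apply/negPn/negP => /extremePn[a [b ins]].
have [/negPf ma /negPf mb] := inside_neq ins; rewrite !(inj_eq pt_inj) in ma mb.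
have := (inside_lex ins).2.
have la : lex a m by apply: mmax; rewrite eq_sym ma.
have lb : lex b m by apply: mmax; rewrite eq_sym mb.
by case/orP => /andP[h1 h2]; [apply: (lexlt_asym lb h2) | apply: (lexlt_asym la h2)].
Qed.

Lemma card_extreme : (1 < #|T|)%N -> (1 < #|extreme|)%N.
Proof.
move=> T1; have [m mmin] := exists_lexmin p0; have [M Mmax] := exists_lexmax p0.
have mM : m != M.
  apply: contraTneq T1 => mM; rewrite -leqNgt; apply/card_le1_eqP => x y _ _.
  have eqm z : z = m.
    apply/eqP/contraT => zm; have l1 := mmin z zm.
    by rewrite mM in zm l1; case: (lexlt_asym l1 (Mmax z zm)).
  by rewrite (eqm x) (eqm y).
have <- : #|[set m; M]| = 2%N by rewrite cards2 mM.
apply: subset_leq_card; apply/subsetP => x; rewrite inE => /orP[] /set1P ->.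
  exact: lexmin_extreme.
exact: lexmax_extreme.
Qed.

(** If the arc left the line [a b], its point farthest from the line, lexicographically least among
    ties, would be extreme: the ends of a segment around it would be equally far and both
    lexicographically larger. If everything is collinear and [b] precedes [a], the arc wraps around
    and contains the lexicographic minimum or maximum, again extreme. *)
Lemma nonextreme_arc_inside a b w : (forall x, cyc a x b -> x \notin extreme) ->
  cyc a w b -> inside a w b.
Proof.
move=> arc cw; have [aw wb ba] := cyc_neq cw.
have arc0 x : cyc a x b -> D a b x = 0.
  move=> cx; apply/eqP/contraT => Dx.
  have neg : D a b x < 0.
    by rewrite lt_neqAle Dx -oppr_ge0 -area_swap cyc_convex.
  case: (@arg_minP _ _ _ x predT (fun y => D a b y) isT) => m1 _ m1min.
  have [|||m [/eqP Dm mmin]] :=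
     @exists_minimum (fun y => D a b y == D a b m1) (fun x y => lex x y) m1 (eqxx _).
  - by move=> y; exact: lexlt_irr.
  - by move=> y z t; exact: lexlt_trans.
  - exact: lex_total.
  have mneg : D a b m < 0 by rewrite Dm; apply: le_lt_trans neg; exact: m1min.
  have cm : cyc a m b.
    have ma : m != a by apply: contraTneq mneg => ->; rewrite (area_aab _ _).1 ltxx.
    have mb : m != b by apply: contraTneq mneg => ->; rewrite (area_aab _ _).2 ltxx.
    apply: contraTT mneg => nc; rewrite -leNgt; apply: cyc_convex.
    by move: nc (neq ma) (neq mb) (neq ba); cyc_lia.
  have /extremePn[u [v ins]] := arc m cm.
  have [_ [t t01 em]] := ins.
  have uge : D a b m <= D a b u by rewrite Dm; exact: m1min.
  have vge : D a b m <= D a b v by rewrite Dm; exact: m1min.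
  have comb : D a b m = (1 - t) * D a b u + t * D a b v by rewrite {1}em area_comb.
  have [mu mv] := inside_neq ins; rewrite !(inj_eq pt_inj) in mu mv.
  have um : D a b u = D a b m by nra.
  have vm : D a b v = D a b m by nra.
  have lu : lex m u by apply: mmin; [rewrite um Dm | rewrite eq_sym].
  have lv : lex m v by apply: mmin; [rewrite vm Dm | rewrite eq_sym].
  case/orP: (inside_lex ins).2 => /andP[h1 h2].
    by case: (lexlt_asym lu h1).
  by case: (lexlt_asym lv h1).
have [col|//] := arc_collinear_inside arc0 cw.
have ab : a != b by rewrite eq_sym.
have {}col := all_collinear ab col.
have lexE := collinear_before col.
apply/insideP; rewrite col eqxx /= -!lexE.
have [ltab|ltba] := ltnP (rank a) (rank b).
  by move: cw ltab; cyc_lia.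
exfalso; have [wa|wa] := ltnP (rank w) (rank a).
  have [m mmin] := exists_lexmin p0.
  have : m \notin extreme; last by rewrite lexmin_extreme.
  apply: arc; have [<-//|mw] := eqVneq w m.
  by have := mmin w mw; rewrite -lexE; move: cw ltba wa; cyc_lia.
have [m mmax] := exists_lexmax p0.
have : m \notin extreme; last by rewrite lexmax_extreme.
apply: arc; have [<-//|mw] := eqVneq w m.
by have := mmax w mw; rewrite -lexE; move: cw ltba wa; cyc_lia.
Qed.

(** If [M1] came before [m2], it would be inside [m1 m2]. By interlacing, [M2] is on the same arc
    between [m1] and [m2], so [inside_arc] would place it before [m2] as well. *)
Lemma overlap_lt p q m1 M1 m2 M2 : p != q -> D p q m1 = 0 -> D p q M1 = 0 ->
  D p q m2 = 0 -> D p q M2 = 0 -> lex m1 m2 -> lex m2 M2 ->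
  cyc m1 m2 M1 && cyc M1 M2 m1 || cyc m1 M2 M1 && cyc M1 m2 m1 ->
  lex m1 M1 -> inside m1 m2 M1.
Proof.
move=> pq h1 h2 h3 h4 l12 l2 link l1; rewrite -(inj_eq pt_inj) in pq.
have m2M1 : m2 != M1 by case/orP: link => /andP[/cyc_neq[? ? ?] /cyc_neq[? ? ?]]; rewrite // eq_sym.
case/orP: (lex_total m2M1) => l21.
  by apply: lex_inside => //; exact: (area_collinear pq).
have ins : inside m1 M1 m2 by apply: lex_inside => //; exact: (area_collinear pq).
suff /inside_lex[_ /orP[] /andP[g1 g2]] : inside m1 M2 m2.
- by case: (lexlt_asym l2 g2).
- by case: (lexlt_asym l12 (lexlt_trans g1 g2)).
case/orP: link => /andP[c1 c2].
  apply: inside_sym; apply: (inside_arc (inside_sym ins)); by move: c1 c2; cyc_lia.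
by apply: (inside_arc ins); move: c1 c2; cyc_lia.
Qed.

Lemma overlap p q m1 M1 m2 M2 : p != q -> D p q m1 = 0 -> D p q M1 = 0 ->
  D p q m2 = 0 -> D p q M2 = 0 -> lex m1 M1 -> lex m2 M2 ->
  cyc m1 m2 M1 && cyc M1 M2 m1 || cyc m1 M2 M1 && cyc M1 m2 m1 ->
  inside m1 m2 M1 \/ inside m2 m1 M2.
Proof.
move=> pq h1 h2 h3 h4 l1 l2 link.
have m12 : m1 != m2 by case/orP: link => /andP[/cyc_neq[? ? ?] /cyc_neq[? ? ?]]; rewrite // eq_sym.
case/orP: (lex_total m12) => l.
  by left; apply: (overlap_lt pq h1 h2 h3 h4).
right; apply: (overlap_lt pq h3 h4 h1 h2) => //.
by move: link; cyc_lia.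
Qed.

(** A quadrilateral of positive area has meeting diagonals. Otherwise the four points are collinear,
    and by [overlap] an end of one segment is inside the other; the cases are the orientations of
    both segments. *)
Lemma crossing_meet a b c d : cyc a b c -> cyc c d a ->
  exists s t, [/\ 0 <= s <= 1, 0 <= t <= 1 &
    (1 - s) *: pt a + s *: pt c = (1 - t) *: pt b + t *: pt d].
Proof.
move=> c1 c2.
have A1 : 0 <= D a b d by apply: cyc_convex; move: c1 c2; cyc_lia.
have A2 : 0 <= D b c d by apply: cyc_convex; move: c1 c2; cyc_lia.
have A3 : 0 <= D a c d by apply: cyc_convex; move: c1 c2; cyc_lia.
have A4 : 0 <= D a b c by apply: cyc_convex; move: c1 c2; cyc_lia.
have eS : D a b d + D b c d = D a c d + D a b c by rewrite /area; ring.
have [S0|S0] := ltrP 0 (D a b d + D b c d).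
  set S := D a b d + D b c d in S0 eS; have Sn : S != 0 by rewrite gt_eqF.
  exists (D a b d / S), (D a b c / S); split.
  - by rewrite divr_ge0 ?(ltW S0) //= ler_pdivrMr // mul1r /S; lra.
  - by rewrite divr_ge0 ?(ltW S0) //= ler_pdivrMr // mul1r eS; lra.
  - have -> : 1 - D a b d / S = D b c d / S.
      by rewrite -(divff Sn) -mulrBl; congr (_ / _); rewrite /S; ring.
    have -> : 1 - D a b c / S = D a c d / S.
      by rewrite -(divff Sn) -mulrBl; congr (_ / _); rewrite eS; ring.
    exact: diagonals_meet.
have bd : b != d by apply: contraTneq c2 => <-; move: c1; cyc_lia.
have ac : a != c by apply: contraTneq c2 => <-; cyc_lia.
have hb : D b d b = 0 by rewrite (area_aab _ _).1.
have hd : D b d d = 0 by rewrite (area_aab _ _).2.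
have ha : D b d a = 0 by rewrite -(area_rot (pt a)); lra.
have hc : D b d c = 0 by rewrite (area_swap (pt b) (pt c)); lra.
have point01 (k : R) : 0 < k < 1 -> 0 <= k <= 1 by lra.
have z01 : 0 <= (0 : R) <= 1 by rewrite lexx /= ler01.
have o01 : 0 <= (1 : R) <= 1 by rewrite ler01 lexx.
have s0 (x y : 'rV[R]_2) : (1 - 0) *: x + 0 *: y = x by rewrite subr0 scale1r scale0r addr0.
have s1 (x y : 'rV[R]_2) : (1 - 1) *: x + 1 *: y = y by rewrite subrr scale1r scale0r add0r.
have meet_b : inside a b c -> exists s t, [/\ 0 <= s <= 1, 0 <= t <= 1 &
    (1 - s) *: pt a + s *: pt c = (1 - t) *: pt b + t *: pt d].
  by case=> _ [s /point01 s01 e]; exists s, 0; rewrite s0 e.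
have meet_d : inside a d c -> exists s t, [/\ 0 <= s <= 1, 0 <= t <= 1 &
    (1 - s) *: pt a + s *: pt c = (1 - t) *: pt b + t *: pt d].
  by case=> _ [s /point01 s01 e]; exists s, 1; rewrite s1 e.
have meet_a : inside b a d -> exists s t, [/\ 0 <= s <= 1, 0 <= t <= 1 &
    (1 - s) *: pt a + s *: pt c = (1 - t) *: pt b + t *: pt d].
  by case=> _ [s /point01 s01 e]; exists 0, s; rewrite s0 e.
have meet_c : inside b c d -> exists s t, [/\ 0 <= s <= 1, 0 <= t <= 1 &
    (1 - s) *: pt a + s *: pt c = (1 - t) *: pt b + t *: pt d].
  by case=> _ [s /point01 s01 e]; exists 1, s; rewrite s1 e.
case/orP: (lex_total ac) => lac; case/orP: (lex_total bd) => lbd.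
- by have [||//] := overlap bd ha hc hb hd lac lbd; [rewrite c1 c2 |..].
- have [||] := overlap bd ha hc hd hb lac lbd; first by move: c1 c2; cyc_lia.
    exact: meet_d.
  by move/inside_sym; exact: meet_a.
- have [||] := overlap bd hc ha hb hd lac lbd; first by move: c1 c2; cyc_lia.
    by move/inside_sym; exact: meet_b.
  exact: meet_c.
- have [||] := overlap bd hc ha hd hb lac lbd; first by move: c1 c2; cyc_lia.
    by move/inside_sym; exact: meet_d.
  by move/inside_sym; exact: meet_c.
Qed.

(** The arc between [a] and [b] that contains [c] lies inside the segment by [inside_arc], hence has
    no extreme point. *)
Lemma flat_inside (e : rel T) : equiv (fun x y => e x y) ->
  flat rank [set: T] extreme (fun x y => e x y) ->
  forall a b c, e a b -> inside a c b -> e a c.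
Proof.
move=> [r s t] fl a b c eab ins.
have [ca cb] := inside_neq ins; rewrite !(inj_eq pt_inj) in ca cb.
have [ab _] := ins; rewrite (inj_eq pt_inj) in ab.
have [h|h] := boolP (cyc a c b).
  apply: (fl a b _ _ eab _ c) => // w _ cw; apply/extremePn; exists a, b.
  exact: inside_arc ins h cw.
have {}h : cyc b c a by move: h (neq ca) (neq cb) (neq ab); cyc_lia.
apply: (t _ _ _ eab); apply: (fl b a _ _ (s _ _ eab) _ c) => // w _ cw.
apply/extremePn; exists b, a; exact: inside_arc (inside_sym ins) h cw.
Qed.

(** Among pairs [p], [q] in the class of [c1] with [b] on the arc from [p] to [q], one with the
    shortest arc leaves no point of that class on it. Noncrossing confines the class of [b] to this
    arc, so the line [p q] separates the two classes weakly. *)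
Lemma separating_line (e : rel T) b c1 c2 : equiv (fun x y => e x y) ->
  noncross rank [set: T] (fun x y => e x y) -> c1 != c2 -> e c1 c2 -> ~~ e c1 b ->
  exists p q, [/\ p != q, forall z, e b z -> D p q z <= 0 &
                          forall z, e c1 z -> 0 <= D p q z].
Proof.
move=> [r s t] nc c12 e12 e1b.
pose P (u : T * T) := [&& e c1 u.1, e c1 u.2 & cyc u.1 b u.2].
have neqb x : e c1 x -> x != b by apply: contraTneq => ->.
have [u0 Pu0] : exists u : T * T, P u.
  have bc1 := neqb _ (r c1); have bc2 := neqb _ e12.
  have [h|h] := boolP (cyc c1 b c2); first by exists (c1, c2); rewrite /P /= r e12 h.
  exists (c2, c1); rewrite /P /= r e12 /=.
  by move: h (neq bc1) (neq bc2) (neq c12); cyc_lia.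
case: (@arg_minnP _ u0 P (fun u : T * T => #|[set w | cyc u.1 w u.2]|) Pu0).
move=> [p q] /and3P[/= ep eq cb] pqmin; have [pb bq qp] := cyc_neq cb.
have arcC z : e c1 z -> ~~ cyc p z q.
  move=> ez; apply/negP => cz; have zb := neqb _ ez.
  have [u [Pu sub]] : exists u : T * T, P u /\ forall w, cyc u.1 w u.2 -> cyc p w q && (w != z).
    have ex v w x : cyc v w x -> (w != v) && (w != x).
      by case/cyc_neq => vw wx _; rewrite eq_sym vw wx.
    have [h|h] := boolP (cyc p b z).
      exists (p, z); rewrite /P /= ep ez h; split=> // w cw; have /andP[_ ->] := ex _ _ _ cw.
      by rewrite andbT; move: cw cz; cyc_lia.
    exists (z, q); rewrite /P /= eq ez; split.
      by move: h cb cz (neq zb); cyc_lia.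
    move=> w cw; have /andP[-> _] := ex _ _ _ cw.
    by rewrite andbT; move: cw cz; cyc_lia.
  have := pqmin u Pu; rewrite leqNgt => /negP[]; apply: proper_card; apply/properP; split.
    by apply/subsetP => w; rewrite !inE => /sub/andP[].
  by exists z; rewrite !inE //; apply/negP => /sub/andP[_]; rewrite eqxx.
exists p, q; split; first by rewrite eq_sym.
  move=> z ebz; rewrite -oppr_ge0 -area_swap; apply: cyc_convex.
  have ecz : ~~ e c1 z by apply: contra e1b => ecz; exact: (t _ _ _ ecz (s _ _ ebz)).
  have zp : z != p by apply: contraNneq ecz => ->.
  have zq : z != q by apply: contraNneq ecz => ->.
  apply: contraT => h; case/negP: e1b; apply: (t _ _ _ ep).
  apply: (nc p b q z); rewrite ?inE //.
    by move: h (neq zp) (neq zq) (neq qp); cyc_lia.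
  exact: (t _ _ _ (s _ _ ep) eq).
move=> z ez; have [->|zp] := eqVneq z p; first by rewrite (area_aab _ _).1.
have [->|zq] := eqVneq z q; first by rewrite (area_aab _ _).2.
apply: cyc_convex; move: (arcC z ez) (neq zp) (neq zq) (neq qp); cyc_lia.
Qed.

End Order.
End Configuration.

From mathcomp Require Import all_classical all_reals topology normedtype convex.
From mathcomp Require Import interval_inference.
Import numFieldNormedType.Exports.
Local Open Scope classical_set_scope.
Local Open Scope ring_scope.

(** * Convex hulls and noncrossing partitions *)

Section ConvexHulls.
Context {R : realType}.
Implicit Types (a b c d p q x y z : plane R) (A X : set (plane R)) (t : R).

Lemma convex_setP A : convex_set A <->
  forall x y t, 0 <= t <= 1 -> A x -> A y -> A ((1 - t) *: x + t *: y).
Proof.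
split=> [cA x y t t01 Ax Ay|cA x y l /set_mem Ax /set_mem Ay]; last first.
  apply/mem_set; have := cA y x l%:num; rewrite addrC; apply => //.
  by rewrite ge0 le1.
have [t0 t1] := andP t01.
have l01 : Itv.spec (@Itv.num_sem R) (Itv.Real `[0%Z, 1%Z]) t.
  by rewrite /Itv.num_sem /= num_real in_itv /= t0 t1.
have /set_mem := cA y x (Itv.mk l01) (mem_set Ay) (mem_set Ax).
by rewrite /conv /= addrC.
Qed.

Lemma convex_hull_sub X A : convex_set A -> X `<=` A -> convex_hull X `<=` A.
Proof. exact: smallest_sub. Qed.

Lemma sub_convex_hull X : X `<=` convex_hull X.
Proof. exact: sub_gen_smallest. Qed.

Lemma convex_hull_comb X x y t : 0 <= t <= 1 -> convex_hull X x ->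
  convex_hull X y -> convex_hull X ((1 - t) *: x + t *: y).
Proof.
move=> t01 hx hy A [cA XA].
by apply: (convex_setP A).1 => //; [apply: hx | apply: hy].
Qed.

(** Barycentric coordinates: [x] lies on a segment from [a] to a point of [b c], which is determined
    unless [x = a]. *)
Lemma convex_hull_triangle X a b c x : convex_hull X a -> convex_hull X b ->
  convex_hull X c -> 0 < area a b c -> 0 <= area a b x -> 0 <= area b c x ->
  0 <= area c a x -> convex_hull X x.
Proof.
move=> ha hb hc S0 Ac Aa Ab; set S := area a b c in S0.
have eS : S = area a b x + area b c x + area c a x by rewrite /S /area; ring.
have Sn : S != 0 by rewrite gt_eqF.
have [bc0|bc0] := eqVneq (area c a x + area a b x) 0.
  have Ab0 : area c a x = 0 by lra.
  have Ac0 : area a b x = 0 by lra.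
  suff -> : x = a by [].
  have eX : (abscissa x - abscissa a) * S = 0.
    transitivity ((abscissa c - abscissa a) * area a b x + (abscissa b - abscissa a) * area c a x).
      by rewrite /S /area; ring.
    by rewrite Ab0 Ac0; ring.
  have eY : (ordinate x - ordinate a) * S = 0.
    transitivity ((ordinate c - ordinate a) * area a b x + (ordinate b - ordinate a) * area c a x).
      by rewrite /S /area; ring.
    by rewrite Ab0 Ac0; ring.
  move/eqP: eX; rewrite mulf_eq0 (negPf Sn) orbF subr_eq0 => /eqP eX.
  move/eqP: eY; rewrite mulf_eq0 (negPf Sn) orbF subr_eq0 => /eqP eY.
  exact: plane_eqP.
set B := area c a x + area a b x in bc0.
have B0 : 0 < B by rewrite lt_neqAle eq_sym bc0 addr_ge0.
have hy := @convex_hull_comb X b c (area a b x / B) _ hb hc.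
have -> : x = (1 - B / S) *: a + (B / S) *: ((1 - area a b x / B) *: b + (area a b x / B) *: c).
  have key (u v w r : R) : r * S = area b c x * u + area c a x * v + area a b x * w ->
      r = (1 - B / S) * u + B / S * ((1 - area a b x / B) * v + area a b x / B * w).
    move=> h; apply: (mulIf Sn); rewrite h.
    have -> : area b c x = S - B by rewrite eS /B; ring.
    have -> : area c a x = B - area a b x by rewrite /B; ring.
    by field; rewrite Sn bc0.
  by apply: plane_eqP; rewrite ?(coord_comb _ _ _ _).1 ?(coord_comb _ _ _ _).2;
    apply: key; rewrite /S /area; ring.
apply: convex_hull_comb => //; last first.
  apply: hy; rewrite divr_ge0 ?(ltW B0) //= ler_pdivrMr // mul1r /B; lra.
by rewrite divr_ge0 ?(ltW B0) ?(ltW S0) //= ler_pdivrMr // mul1r eS /B; lra.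
Qed.

Lemma area_near a b p : 0 < area a b p -> \forall x \near p, 0 < area a b x.
Proof.
move=> h; have cont : (area a b x @[x --> p]) --> area a b p.
  have cX : (abscissa x @[x --> p]) --> abscissa p by exact: coord_continuous.
  have cY : (ordinate x @[x --> p]) --> ordinate p by exact: coord_continuous.
  exact: (cvgB (cvgM (cvg_cst (abscissa b - abscissa a)) (cvgB cY (cvg_cst _)))
               (cvgM (cvg_cst (ordinate b - ordinate a)) (cvgB cX (cvg_cst _)))).
exact: (cvgr_gt _ cont).
Qed.

Lemma interior_triangle X a b c p : convex_hull X a -> convex_hull X b ->
  convex_hull X c -> 0 < area a b p -> 0 < area b c p -> 0 < area c a p ->
  interior (convex_hull X) p.
Proof.
move=> ha hb hc h1 h2 h3; have S0 : 0 < area a b c.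
  have -> : area a b c = area a b p + area b c p + area c a p by rewrite /area; ring.
  by apply: addr_gt0 => //; exact: addr_gt0.
near=> x; apply: (convex_hull_triangle ha hb hc S0).
- by apply: ltW; near: x; exact: area_near.
- by apply: ltW; near: x; exact: area_near.
- by apply: ltW; near: x; exact: area_near.
Unshelve. all: by end_near.
Qed.

(** The triangles [a b c] and [a d b], glued along [a b], cover a neighbourhood of [p]. *)
Lemma interior_crossing X a b c d p : convex_hull X a -> convex_hull X b ->
  convex_hull X c -> convex_hull X d -> inside a p b -> 0 < area a b c ->
  area a b d < 0 -> interior (convex_hull X) p.
Proof.
move=> ha hb hc hd [_ [t t01 ep]] h1 h2.
have bcp : 0 < area b c p.
  rewrite ep area_comb (area_aab _ _).1 mulr0 addr0 -(area_rot a) mulr_gt0 //; lra.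
have cap : 0 < area c a p.
  rewrite ep area_comb (area_aab _ _).2 mulr0 add0r (area_rot c) mulr_gt0 //; lra.
have adp : 0 < area a d p.
  rewrite ep area_comb (area_aab _ _).1 mulr0 add0r area_swap mulr_gt0 //; lra.
have dbp : 0 < area d b p.
  rewrite ep area_comb (area_aab _ _).2 mulr0 addr0 (area_rot d) (area_rot b) area_swap.
  by rewrite mulr_gt0 //; lra.
near=> x.
have [abx|abx] := lerP 0 (area a b x).
  apply: (convex_hull_triangle ha hb hc) => //.
  - by apply: ltW; near: x; exact: area_near.
  - by apply: ltW; near: x; exact: area_near.
apply: (convex_hull_triangle ha hd hb).
- by rewrite area_swap; lra.
- by apply: ltW; near: x; exact: area_near.
- by apply: ltW; near: x; exact: area_near.
- by rewrite area_rot area_swap; lra.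
Unshelve. all: by end_near.
Qed.

End ConvexHulls.

(** * Convex hulls bounded by a line *)

Section LinesAndHulls.
Context {R : realType}.
Implicit Types (a b c p q x y z : plane R) (X : set (plane R)) (t : R).

Lemma lexle_trans a b c : ~~ lexlt b a -> ~~ lexlt c b -> ~~ lexlt c a.
Proof.
move=> ab bc; apply/negP => ca.
have [e|ne] := eqVneq a b; first by rewrite e in ca; rewrite ca in bc.
case/orP: (lexlt_total ne) => [ab'|ba]; last by rewrite ba in ab.
by rewrite (lexlt_trans ca ab') in bc.
Qed.

Lemma lexle_comb c x y t : 0 <= t <= 1 ->
  (~~ lexlt x c -> ~~ lexlt y c -> ~~ lexlt ((1 - t) *: x + t *: y) c) /\
  (~~ lexlt c x -> ~~ lexlt c y -> ~~ lexlt c ((1 - t) *: x + t *: y)).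
Proof.
move=> t01; have [->|t0] := eqVneq t 0; first by rewrite subr0 scale1r scale0r addr0.
have [->|t1] := eqVneq t 1; first by rewrite subrr scale1r scale0r add0r.
have t01' : 0 < t < 1 by rewrite !lt_neqAle eq_sym t0 t1.
have [->|xy] := eqVneq x y; first by rewrite -scalerDl subrK scale1r.
case/orP: (lexlt_total xy) => l.
  have [l1 l2] := lexlt_comb l t01'; split=> h1 h2.
    by apply: (lexle_trans h1); apply/negP => /(lexlt_asym l1).
  by apply: lexle_trans h2; apply/negP => /(lexlt_asym l2).
have s01 : 0 < 1 - t < 1 by lra.
have := lexlt_comb l s01; rewrite subKr addrC => -[l1 l2]; split=> h1 h2.
  by apply: (lexle_trans h2); apply/negP => /(lexlt_asym l1).
by apply: lexle_trans h1; apply/negP => /(lexlt_asym l2).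
Qed.

Lemma convex_hull_halfplane p q X : (forall x, X x -> area p q x <= 0) ->
  forall x, convex_hull X x -> area p q x <= 0.
Proof.
move=> hX; apply: convex_hull_sub => //; apply/convex_setP => x y t t01 /= hx hy.
by rewrite area_comb; nra.
Qed.

(** The open half-plane, together with the points of its boundary line lying lexicographically
    between two points of [X] on that line, is a convex set containing [X]. *)
Lemma convex_hull_face p q X : (forall x, X x -> area p q x <= 0) ->
  forall x, convex_hull X x -> area p q x = 0 ->
  (exists b, [/\ X b, area p q b = 0 & ~~ lexlt x b]) /\
  (exists b, [/\ X b, area p q b = 0 & ~~ lexlt b x]).
Proof.
move=> hX.
pose U x := (exists b, [/\ X b, area p q b = 0 & ~~ lexlt x b]) /\
  (exists b, [/\ X b, area p q b = 0 & ~~ lexlt b x]).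
suff H : convex_hull X `<=` [set x | area p q x < 0 \/ area p q x = 0 /\ U x].
  by move=> x /H[h e|[]//]; rewrite e ltxx in h.
apply: convex_hull_sub; last first.
  move=> x Xx /=; have := hX x Xx; rewrite le_eqVlt => /orP[/eqP e|]; last by left.
  by right; split=> //; split; exists x; rewrite lexlt_irr.
apply/convex_setP => x y t t01 /=.
have [->|t0] := eqVneq t 0; first by rewrite subr0 scale1r scale0r addr0.
have [->|t1] := eqVneq t 1; first by rewrite subrr scale1r scale0r add0r.
have t01' : 0 < t < 1 by rewrite !lt_neqAle eq_sym t0 t1.
rewrite area_comb => -[h1|[e1 [[b1 [Xb1 Db1 l1]] [d1 [Xd1 Dd1 m1]]]]].
  by move=> [h2|[e2 _]]; left; nra.
move=> [h2|[e2 [[b2 [Xb2 Db2 l2]] [d2 [Xd2 Dd2 m2]]]]]; first by left; nra.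
right; split; first by rewrite e1 e2 !mulr0 addr0.
split.
  have [b12|b12] := boolP (lexlt b2 b1).
    exists b2; split=> //; apply: (lexle_comb b2 x y t01).1 => //.
    by apply: lexle_trans l1; apply/negP => /(lexlt_asym b12).
  exists b1; split=> //; apply: (lexle_comb b1 x y t01).1 => //.
  by apply: lexle_trans l2.
have [d12|d12] := boolP (lexlt d1 d2).
  exists d2; split=> //; apply: (lexle_comb d2 x y t01).2 => //.
  by apply: (lexle_trans m1); apply/negP => /(lexlt_asym d12).
exists d1; split=> //; apply: (lexle_comb d1 x y t01).2 => //.
by apply: (lexle_trans m2).
Qed.

Lemma dim1_area (V : {vspace plane R}) a b c : \dim V = 1%N -> b - a \in V ->
  c - a \in V -> area a b c = 0.
Proof.
move=> dV; have -> : V = <[vpick V]>%VS.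
  apply/eqP; rewrite eq_sym eqEdim -memvE memv_pick dim_vline dV.
  by rewrite vpick0 -dimv_eq0 dV.
move=> /vlineP[s es] /vlineP[t et].
have -> : b = a + s *: vpick V by rewrite -es addrC subrK.
have -> : c = a + t *: vpick V by rewrite -et addrC subrK.
by rewrite /area /abscissa /ordinate !mxE; ring.
Qed.

End LinesAndHulls.

(** * Noncrossing partitions of a hull configuration as good relations *)

Section HullConfiguration.
Context {R : realType} {P : {fset plane R}}.
Hypothesis hullP : hull_configuration P.
Local Notation T := (fset_sub_type P).
Local Notation pt := (val : T -> plane R).
Local Notation D x y z := (area (pt x) (pt y) (pt z)).
Implicit Types (x y z w : T).

Lemma pt_inj : injective pt. Proof. exact: val_inj. Qed.

Lemma pt_hull x : convex_hull [set` P] (pt x).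
Proof. by apply: sub_convex_hull; exact: valP. Qed.

Lemma collinear_or_no_interior :
  (forall x y z, D x y z = 0) \/
  (forall x, ~ interior (convex_hull [set` P]) (pt x)).
Proof.
case: hullP => [[_ [V [Vd _] dV]]|no]; last by right=> x; apply: no; exact: valP.
by left=> x y z; apply: (dim1_area dV); apply: Vd; exact: pt_hull.
Qed.

Lemma no_triangle x y z w : 0 < D x y w -> 0 < D y z w -> 0 < D z x w -> False.
Proof.
case: collinear_or_no_interior => [col|no] h1 h2 h3; first by rewrite col ltxx in h1.
by apply: (no w); apply: (interior_triangle (pt_hull x) (pt_hull y) (pt_hull z)).
Qed.

Lemma no_crossing x y z w p : inside (pt x) (pt p) (pt y) -> 0 < D x y z ->
  D x y w < 0 -> False.
Proof.
case: collinear_or_no_interior => [col|no] h1 h2 h3; first by rewrite col ltxx in h2.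
apply: (no p).
exact: (interior_crossing (pt_hull x) (pt_hull y) (pt_hull z) (pt_hull w) h1 h2 h3).
Qed.

Section Base.
Context (p0 : T).
Hypothesis p0_min : forall x, x != p0 -> lexlt (pt p0) (pt x).
Local Notation rank := (rank pt p0).
Local Notation extreme := (extreme pt).

Definition cell (e : rel T) x : {set T} := [set z | e x z]%SET.

(** A common point of the hulls lies on the separating line, and [convex_hull_face] places it
    between two points of either class on that line. Of two intervals with a common point, one
    contains the lower end of the other; [flat_inside] then merges the classes. *)
Lemma cells_disjoint_line (e : rel T) x y y' :
  equiv (fun u v => e u v) -> good rank [set: T]%SET extreme (fun u v => e u v) ->
  y != y' -> e y y' -> ~~ e y x ->
  forall p, convex_hull (block_points (cell e x)) p ->
            convex_hull (block_points (cell e y)) p -> False.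
Proof.
move=> eqv [nc fl] yy' eyy' eyx p hx hy.
have [r s t] := eqv.
have flin := flat_inside pt_inj no_triangle no_crossing p0_min eqv fl.
have [u [v [uv hB hC]]] := separating_line pt_inj no_triangle no_crossing p0_min eqv nc yy' eyy' eyx.
have hB' q : block_points (cell e x) q -> area (pt u) (pt v) q <= 0.
  by case=> z /=; rewrite inE => exz <-; exact: hB.
have hC' q : block_points (cell e y) q -> area (pt v) (pt u) q <= 0.
  case=> z /=; rewrite inE => eyz <-; rewrite area_rot area_swap oppr_le0.
  exact: hC.
have vu q : area (pt v) (pt u) q = - area (pt u) (pt v) q by rewrite area_rot area_swap.
have D0 : area (pt u) (pt v) p = 0.
  have := convex_hull_halfplane hB' hx; have := convex_hull_halfplane hC' hy.
  by rewrite vu; lra.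
have D0' : area (pt v) (pt u) p = 0 by rewrite vu D0 oppr0.
have [[_ [[b1 eb1 <-] Db1 lb1]] [_ [[b2 eb2 <-] Db2 lb2]]] := convex_hull_face hB' hx D0.
have [[_ [[c1 ec1 <-] Dc1 lc1]] [_ [[c2 ec2 <-] Dc2 lc2]]] := convex_hull_face hC' hy D0'.
move: eb1 eb2 ec1 ec2; rewrite /= !inE => eb1 eb2 ec1 ec2.
have {}Dc1 : D u v c1 = 0 by apply: oppr_inj; rewrite -vu Dc1 oppr0.
have {}Dc2 : D u v c2 = 0 by apply: oppr_inj; rewrite -vu Dc2 oppr0.
have uv' : pt u != pt v by rewrite (inj_eq pt_inj).
have sep b c : e x b -> e y c -> ~~ e b c.
  move=> eb ec; apply: contra eyx => ebc; apply: (t _ _ _ ec); apply: (s _ _).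
  exact: t eb ebc.
have neq b c : e x b -> e y c -> b != c.
  by move=> eb ec; apply: contraNneq (sep b c eb ec) => <-.
have lt12 b c q : b != c -> ~~ lexlt q (pt b) -> ~~ lexlt (pt c) q -> lexlt (pt b) (pt c).
  move=> bc h1 h2; have := lexle_trans h1 h2.
  by case/orP: (lex_total pt_inj bc) => // ->.
case/orP: (lex_total pt_inj (neq _ _ eb1 ec1)) => l.
  have l2 : lexlt (pt c1) (pt b2) by apply: lt12 lc1 lb2; rewrite eq_sym neq.
  have ins : inside (pt b1) (pt c1) (pt b2).
    by apply: lex_inside => //; exact: (area_collinear uv').
  have e12 : e b1 b2 by exact: (t _ _ _ (s _ _ eb1) eb2).
  by have := sep _ _ eb1 ec1; rewrite (flin _ _ _ e12 ins).
have l2 : lexlt (pt b1) (pt c2) by apply: lt12 lb1 lc2; rewrite neq.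
have ins : inside (pt c1) (pt b1) (pt c2).
  by apply: lex_inside => //; exact: (area_collinear uv').
have e12 : e c1 c2 by exact: (t _ _ _ (s _ _ ec1) ec2).
have := sep _ _ eb1 ec1; rewrite (s _ _ (flin _ _ _ e12 ins)) //.
Qed.

(** A separating line is available once either class has two points; two singletons are their own
    hulls. *)
Lemma cells_disjoint (e : rel T) x y :
  equiv (fun u v => e u v) -> good rank [set: T]%SET extreme (fun u v => e u v) ->
  ~~ e x y ->
  convex_hull (block_points (cell e x)) `&` convex_hull (block_points (cell e y)) = set0.
Proof.
move=> eqv gd exy; have [r s t] := eqv.
have eyx : ~~ e y x by apply: contra exy; exact: s.
apply/seteqP; split=> // p [hx hy].
have [/existsP[y' /andP[yy' e']]|no_y] := boolP [exists y', (y != y') && e y y'].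
  exact: (cells_disjoint_line eqv gd yy' e' eyx hx hy).
have [/existsP[x' /andP[xx' e']]|no_x] := boolP [exists x', (x != x') && e x x'].
  exact: (cells_disjoint_line eqv gd xx' e' exy hy hx).
have single z : ~~ [exists z', (z != z') && e z z'] ->
    convex_hull (block_points (cell e z)) `<=` [set pt z].
  move=> no; apply: convex_hull_sub.
    by apply/convex_setP => u v k _ /= -> ->; rewrite -scalerDl subrK scale1r.
  move=> q [z' /=]; rewrite inE => ez <-; suff -> : z' = z by [].
  apply/eqP/contraT => zz'.
  by case/negP: no; apply/existsP; exists z'; rewrite eq_sym zz' ez.
have := single x no_x p hx; rewrite (single y no_y p hy) => /pt_inj yx.
by move: exy; rewrite yx r.
Qed.

(** Blocks whose hulls share a point are equal. Interlaced chords share one by [crossing_meet], and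
    a point on an arc without extreme points is itself on the chord. *)
Lemma NC_good (pi : NC P) : good rank [set: T]%SET extreme
  (fun x y => finset.pblock (val pi) x = finset.pblock (val pi) y).
Proof.
have /andP[part /asboolP nc] := valP pi.
have [cov triv nz] := and3P part.
have mem x : finset.pblock (val pi) x \in val pi.
  by apply: finset.pblock_mem; rewrite (eqP cov) finset.inE.
have memx x : x \in finset.pblock (val pi) x by rewrite finset.mem_pblock (eqP cov) finset.inE.
have hull x z : finset.pblock (val pi) x = finset.pblock (val pi) z ->
    convex_hull (block_points (finset.pblock (val pi) x)) (pt z).
  by move=> xz; apply: sub_convex_hull; exists z => //=; rewrite xz.
have meet x y p : convex_hull (block_points (finset.pblock (val pi) x)) p ->
    convex_hull (block_points (finset.pblock (val pi) y)) p ->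
    finset.pblock (val pi) x = finset.pblock (val pi) y.
  move=> hx hy; apply/eqP/contraT => ne.
  by have : [set: plane R] p by []; rewrite -(setC0) -(nc _ _ (mem x) (mem y) ne); case.
split=> [a b c d _ _ _ _ c1 c2 ac bd|u v _ _ uv arc w _ cw].
  have [s [t [s01 t01 e]]] := crossing_meet pt_inj no_triangle no_crossing p0_min c1 c2.
  apply: (meet a b ((1 - s) *: pt a + s *: pt c)).
    by apply: convex_hull_comb => //; apply: hull.
  by rewrite e; apply: convex_hull_comb => //; apply: hull.
have arc' x : cyc_order rank u x v -> x \notin extreme by move=> cx; apply: arc; rewrite ?finset.inE.
have [_ [t t01 e]] := nonextreme_arc_inside pt_inj no_triangle no_crossing p0_min arc' cw.
apply: (meet u w (pt w)); last by apply: hull.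
by rewrite e; apply: convex_hull_comb; [lra | apply: hull..].
Qed.

End Base.
End HullConfiguration.

(** * The Boolean family through a noncrossing partition *)

Section BooleanFamily.
Context {R : realType} {P : {fset plane R}}.
Hypothesis hullP : hull_configuration P.
Local Notation T := (fset_sub_type P).
Local Notation k := (#|{: T}|.-1).

Definition linked (chi : nat -> T -> bool) (A : {set 'I_k}) : rel T :=
  fun x y => [forall i : 'I_k, (i \notin A) ==> (chi i x == chi i y)].

Lemma linkedP chi (A : {set 'I_k}) x y :
  reflect (joined k chi (fun e => [exists i in A, e == i :> nat]) x y) (linked chi A x y).
Proof.
apply: (iffP forallP) => [h e en Ae|h i]; last first.
  apply/implyP => iA; apply/eqP; apply: h => //; apply: contra iA => /exists_inP[j jA].
  by move=> /eqP/val_inj ->.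
apply/eqP; apply: (implyP (h (Ordinal en))); apply: contra Ae => eA.
by apply/exists_inP; exists (Ordinal en).
Qed.

Lemma linked_equiv chi A : equiv (fun x y => linked chi A x y).
Proof.
split=> [x|x y /forallP h|x y z /forallP h1 /forallP h2].
- by apply/forallP => i; rewrite eqxx implybT.
- by apply/forallP => i; rewrite eq_sym.
- apply/forallP => i; apply/implyP => iA.
  by rewrite (eqP (implyP (h1 i) iA)) (implyP (h2 i) iA).
Qed.

(** The first clause, witnessed by the ends of the edge [i], expresses independence of the cuts;
    through it, inclusion of edge sets can be recovered from refinement of partitions. *)
Lemma exists_cut_family (pi : NC P) : exists (chi : nat -> T -> bool) (A0 : {set 'I_k}),
  [/\ forall i : 'I_k, exists x y, chi i x != chi i y /\
        forall j : 'I_k, j != i -> chi j x = chi j y,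
      forall (A : {set 'I_k}) x y, ~~ linked chi A x y ->
        convex_hull (block_points (cell (linked chi A) x)) `&`
        convex_hull (block_points (cell (linked chi A) y)) = set0 &
      forall x y, (finset.pblock (val pi) x == finset.pblock (val pi) y) = linked chi A0 x y].
Proof.
(* An empty configuration has no base point; there [k] is the truncated predecessor of 0, hence 0,
   and all clauses are vacuous. *)
have [T0|/card_gt0P[x0 _]] := posnP #|{: T}|.
  exists (fun _ _ => false), finset.set0; split.
  - by move=> i; have := ltn_ord i; rewrite {2}T0.
  - by move=> A x; have := card0_eq T0 x.
  - by move=> x; have := card0_eq T0 x.
have [p0 p0_min] := exists_lexmin pt_inj x0.
have cardT : #|[set: T]%SET| = k.+1 by rewrite cardsT prednK //; apply/card_gt0P; exists x0.
have V2 : (0 < k)%N -> (1 < #|extreme (val : T -> plane R)|)%N.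
  move=> k0; apply: (card_extreme pt_inj p0); move: k0 cardT; rewrite cardsT.
  by move=> k0 ->.
have [chi [a [b [A0 [tree gd colE]]]]] := tree_existence
  (rank_inj pt_inj p0_min) cardT
  (finset.subsetT _) V2 (NC_good hullP p0_min pi).
exists chi, [set i : 'I_k | A0 i]%SET; split.
- move=> i; exists (a i), (b i); split; first exact: (ct_cut tree).
  by move=> j ji; apply: (ct_other tree).
- move=> A x y nl; apply: (cells_disjoint hullP p0_min) => //; first exact: linked_equiv.
  have [nc fl] := gd (fun e => [exists i in A, e == i :> nat]).
  split=> [u v w z uS vS wS zS h1 h2 /linkedP h3 /linkedP h4|u v uS vS /linkedP h1 h2 w wS h3].
    by apply/linkedP; exact: (nc u v w z).
  by apply/linkedP; exact: (fl u v).
- move=> x y; apply/eqP/idP => [/(colE x y)|l].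
    move=> h; apply/linkedP => e en Ae; apply: h; rewrite ?finset.inE //.
    apply: contra Ae => eA; apply/exists_inP; exists (Ordinal en) => //.
    by rewrite finset.inE.
  apply/(colE x y); rewrite ?finset.inE // => e en Ae.
  have /forallP/(_ (Ordinal en)) := l; rewrite finset.inE Ae /=.
  by move/eqP.
Qed.

End BooleanFamily.

Theorem theorem3p9 (R : realType) (n : nat) (P : {fset plane R})
    (cardP : #|` P | = n) (hullP : hull_configuration P) :
  forall pi : NC P,
    exists S : {set NC P}, pi \in S /\ boolean_subposet S n.-1.
Proof.
move=> pi; have -> : n = #|{: fset_sub_type P}| by rewrite -cardP cardfE.
set k := _.-1; have [chi [A0 [edge disj piE]]] := exists_cut_family hullP pi.
pose part A := equivalence_partition (linked chi A) [set: fset_sub_type P]%SET.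
have eqr A : {in [set: fset_sub_type P]%SET & &, equivalence_rel (linked chi A)}.
  have [r s t] := linked_equiv chi A; move=> x y z _ _ _; split; first exact: r.
  by move=> xy; apply/idP/idP; [exact: t (s _ _ xy) | exact: t xy].
have partE A B : B \in part A -> exists x, B = cell (linked chi A) x.
  case/imsetP => x _ ->; exists x; apply/finset.setP => y.
  by rewrite !finset.inE.
have partI A x : cell (linked chi A) x \in part A.
  apply/imsetP; exists x; rewrite ?finset.inE //; apply/finset.setP => y.
  by rewrite !finset.inE.
have partNC A : finset.partition (part A) [set: fset_sub_type P]%SET && `[< noncrossing (part A) >].
  apply/andP; split; first exact: equivalence_partitionP.
  apply/asboolP => B C /partE[x ->] /partE[y ->] ne; apply: disj.
  apply: contra ne => xy; apply/eqP/finset.setP => z; rewrite !finset.inE.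
  have [r s t] := linked_equiv chi A.
  by apply/idP/idP; [exact: t (s _ _ xy) | exact: t xy].
pose f A : NC P := exist _ (part A) (partNC A).
have fle A B : (f A <= f B)%O = (A \subset B).
  apply/refinesP/fintype.subsetP => [h i iA|AB C /partE[x ->]].
    (* Only the cut [i] separates [x] from [y], so they are linked by [A], and by refinement by [B];
       this is impossible if [i] is outside [B]. *)
    have [x [y [ne same]]] := edge i.
    have [_ /partE[z ->] sub] := h _ (partI A x).
    have xy : linked chi A x y.
      by apply/forallP => j; apply/implyP => jA; rewrite same //; apply: contraNneq jA => ->.
    have [r s t] := linked_equiv chi A; have [r' s' t'] := linked_equiv chi B.
    have zx : linked chi B z x by have := fintype.subsetP sub x; rewrite !finset.inE; apply; exact: r.
    have zy : linked chi B z y by have := fintype.subsetP sub y; rewrite !finset.inE; apply.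
    apply: contraT => iB; case/negP: ne.
    by have /forallP/(_ i) := t' _ _ _ (s' _ _ zx) zy; rewrite iB.
  exists (cell (linked chi B) x); first exact: partI.
  apply/fintype.subsetP => y; rewrite !finset.inE => /forallP h; apply/forallP => i.
  by apply/implyP => iB; apply: (implyP (h i)); apply: contra iB; exact: AB.
have finj : injective f.
  by move=> A B AB; apply/eqP; rewrite finset.eqEsubset -!fle AB lexx.
exists [set f A | A in [set: {set 'I_k}]]%SET; split.
  apply/imsetP; exists A0; rewrite ?finset.inE //; apply: val_inj => /=.
  have /andP[pp _] := valP pi; have [cov triv nz] := and3P pp.
  rewrite -[LHS](equivalence_partition_pblock pp); apply: eq_imset => x.
  apply/finset.setP => y; rewrite !finset.inE -piE eq_pblock //.
  by rewrite (eqP cov) finset.inE.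
pose g A : {x | x \in [set f A | A in [set: {set 'I_k}]]%SET} :=
  exist _ (f A) (imset_f f (finset.in_setT A)).
exists g; split; last exact: fle.
apply: inj_card_bij => [A B /(congr1 val) /finj //|].
by rewrite card_sig card_imset // cardsT.
Qed.
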